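(* Let $n\geq 3$ be an integer and let $\mathbb{K}$ be a field of characteristic not equal to $2$ containing $n$ distinct $n$-th roots of $1$. Let $$I=\bigl(x(y^n-z^n),\; y(z^n-x^n),\; z(x^n-y^n)\bigr)\subset R=\mathbb{K}[x,y,z].$$ Then $$\widehat{\rho}(I)=\frac{n+1}{n}\quad\text{and}\quad \rho(I)=\frac{3}{2}.$$
   Context: Let $R=\mathbb{K}[x_0,\ldots,x_N]$ be a polynomial ring over a field $\mathbb{K}$ with its standard grading, and let $(0)\neq I\subsetneq R$ be a homogeneous ideal. The $m$-th symbolic power of $I$ is $I^{(m)}=R\cap\bigl(\bigcap_{P\in\operatorname{Ass}(I)}I^mR_P\bigr)$, where $\operatorname{Ass}(I)$ is the set of associated primes of $R/I$ and the intersection takes place in the fraction field $R_{(0)}$ of $R$. (If $I=\bigcap_i I_{p_i}$ is the ideal of a finite set of points $p_i\in\mathbf{P}^N(\mathbb{K})$, then $I^{(m)}=\bigcap_i I_{p_i}^m$.) The resurgence of $I$ is $$\rho(I)=\sup\Big\{\frac{m}{r}: I^{(m)}\not\subseteq I^r\Big\},$$ and the asymptotic resurgence of $I$ is $$\widehat{\rho}(I)=\sup\Big\{\frac{m}{r}: I^{(mt)}\not\subseteq I^{rt}\ \text{ for all } t\gg 0\Big\},$$ where $m,r$ range over positive integers. *)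

(* Defs.v *)
From HB Require Import structures.
From mathcomp Require Import all_boot all_order all_algebra.
From mathcomp Require Import classical_sets reals constructive_ereal ereal.

Set Implicit Arguments.
Unset Strict Implicit.
Unset Printing Implicit Defensive.

Import GRing.Theory.
Local Open Scope classical_set_scope.
Local Open Scope ring_scope.

Section Ideals.
Variable A : comNzRingType.
Implicit Types (I J P S : set A).

Definition is_ideal J : Prop :=
  [/\ J 0,
      forall f g, J f -> J g -> J (f + g) &
      forall a f, J f -> J (a * f)].

Definition ideal_gen S : set A := smallest is_ideal S.

(* The empty product gives I^0 = A. *)
Definition ideal_pow I (m : nat) : set A :=
  ideal_gen [set f | exists2 g : 'I_m -> A, (forall i, I (g i)) &
                                            f = \prod_(i < m) g i].

Definition prime_ideal P : Prop :=
  [/\ is_ideal P, ~ P 1 & forall f g, P (f * g) -> P f \/ P g].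

(* The associated primes of the A-module A/I: the prime ideals that are the
   annihilator (I : f) of the class of some f. *)
Definition Ass I : set (set A) :=
  [set P | prime_ideal P /\ exists f, P = [set g | I (g * f)]].

End Ideals.

Section Symbolic.
Variable A : idomainType.
Implicit Types (I J P : set A).

(* The extension J A_P of J to the localization at P, inside Frac(A); the
   denominators s are nonzero since a prime P contains 0. *)
Definition localized_ideal J P : set {fraction A} :=
  [set u | exists a s, [/\ J a, ~ P s & u = tofrac a / tofrac s]].

Definition symbolic_power I (m : nat) : set A :=
  @tofrac A @^-1`
    (\bigcap_(P in Ass I) localized_ideal (ideal_pow I m) P).

End Symbolic.

Section Resurgence.
Variables (R : realType) (A : idomainType).
Implicit Types (I : set A).

(* The suprema are taken in the extended reals, so that an equality with a
   finite value entails that the set is nonempty and bounded above. *)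
Definition resurgence I : \bar R :=
  ereal_sup [set q | exists m r : nat,
    [/\ (0 < m)%N, (0 < r)%N,
        ~ (symbolic_power I m `<=` ideal_pow I r) &
        q = (m%:R / r%:R)%:E]].

Definition asymptotic_resurgence I : \bar R :=
  ereal_sup [set q | exists m r : nat,
    [/\ (0 < m)%N, (0 < r)%N,
        exists t0 : nat, forall t : nat, (t0 <= t)%N ->
          ~ (symbolic_power I (m * t) `<=` ideal_pow I (r * t)) &
        q = (m%:R / r%:R)%:E]].

End Resurgence.
Arguments resurgence R {A} I.
Arguments asymptotic_resurgence R {A} I.

(* Main.v *)
Require Import Defs.
From HB Require Import structures.
From mathcomp Require Import all_boot all_order all_algebra.
From mathcomp Require Import mpoly zify ring lra.
From mathcomp Require Import boolp classical_sets reals constructive_ereal.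
From mathcomp Require Import ereal.

Set Implicit Arguments.
Unset Strict Implicit.
Unset Printing Implicit Defensive.

Import Order.TTheory GRing.Theory Num.Theory.

Local Open Scope classical_set_scope.
Local Open Scope ring_scope.

(** Write X, Y, Z for x^n, y^n, z^n and A = Y - Z, B = Z - X, C = X - Y, so that
    I = (xA, yB, zC) is the ideal of the three coordinate points together with
    the n^2 points where X = Y = Z.  In terms of X, Y, Z these last points
    become the single point (1 : 1 : 1), and X, Y, Z, A, B, C are the six lines
    joining four points in general position in the plane.  The whole proof is
    written in terms of the products x^i y^j z^k A^a B^b C^c of lines.

    Upper bounds.  A form of I^(m) vanishes to order m at all the points.  As in
    the Cox ring of a del Pezzo surface of degree 5, a form with prescribed
    orders at four general points is a linear combination of products of the six
    lines with the same orders (fat_form_line_span, which is proved by dividing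
    by the line A when Bezout forces it, and by restricting to the line x = 0
    otherwise).  It remains to see when a product of lines of order at least r
    at the points lies in I^r.  If its degree is at least (n+1)r + 2n - 3, the
    linear relations between the lines rewrite it as a combination of multiples
    of xA, yB and zC whose cofactors are products of lines of order at least
    r - 1 (line_prod_peel), and induction on r puts it in I^r
    (line_prod_fermat_pow).  Since forms of order m have degree at least nm, this
    shows that I^(m) is contained in I^r as soon as r <= m and
    nm >= (n+1)r + 2n - 3 (symbolic_sub_pow).  This inequality holds whenever
    m/r > 3/2 and r >= 2 (the case r = 1 is symbolic_sub), and for (mt, rt) with
    t large whenever m/r > (n+1)/n.

    Lower bounds.  The product (ABC)^k lies in I^(3k) (three_lines_symbolic) and
    has degree 3nk, while I^r starts in degree (n+1)r; this gives (n+1)/n.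
    Finally ABC is not in I^2 when 2 is not zero (three_lines_notin_sq), which
    gives 3/2.

    The passage from I^(m) to orders of vanishing uses explicit associated
    primes of I: the kernels of the evaluations along the lines through the
    origin that represent the points.  Orders at the coordinate points are read
    off the exponents of monomials.  At the other points, order at least m means
    membership in the power (A, B)^m of a complete intersection, and the point
    to prove is that this may be tested locally (pair_local_pair_pow). *)

(** * Products of the six lines *)

Section Mono.
Variables (A : comNzRingType) (n : nat).

Definition line_prod (x y z : A) (i j k a b c : nat) : A :=
  x ^+ i * y ^+ j * z ^+ k *
  ((y ^+ n - z ^+ n) ^+ a * (z ^+ n - x ^+ n) ^+ b * (x ^+ n - y ^+ n) ^+ c).

(** Lower bounds for the orders of the product at the four points: [m0] at
    X = Y = Z, and [m1], [m2], [m3] at (1 : 0 : 0), (0 : 1 : 0), (0 : 0 : 1).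
    Through the first coordinate point pass y = 0 and z = 0, and the [n] factors
    of A; similarly for the other two. *)
Definition line_ord (m0 m1 m2 m3 i j k a b c : nat) : bool :=
  [&& m0 <= a + b + c, m1 <= n * a + j + k, m2 <= n * b + i + k
    & m3 <= n * c + i + j]%N.

Definition line_deg (i j k a b c : nat) : nat := (i + j + k + n * (a + b + c))%N.

(** The cyclic symmetry, which reduces many of the cases below to one third. *)
Lemma line_prod_rot x y z i j k a b c :
  line_prod y z x j k i b c a = line_prod x y z i j k a b c.
Proof. rewrite /line_prod; ring. Qed.

Lemma line_prod_x x y z i j k a b c :
  line_prod x y z i.+1 j k a b c = x * line_prod x y z i j k a b c.
Proof. by rewrite /line_prod exprS -!mulrA. Qed.

Lemma line_prod_a x y z i j k a b c :
  line_prod x y z i j k a.+1 b c = (y ^+ n - z ^+ n) * line_prod x y z i j k a b c.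
Proof. rewrite /line_prod exprS; ring. Qed.

Lemma line_prod0 y z j k b c : (0 < n)%N ->
  line_prod 0 y z 0 j k 0 b c =
  (-1) ^+ c * (y ^+ (j + n * c) * z ^+ (k + n * b)).
Proof.
move=> n0; rewrite /line_prod !expr0 !mul1r expr0n gtn_eqF // subr0 sub0r (exprNn (y ^+ n)).
by rewrite -!exprM !exprD; move: ((-1) ^+ c) => e; ring.
Qed.

Lemma line_ord_rot m0 m1 m2 m3 i j k a b c :
  line_ord m0 m2 m3 m1 j k i b c a = line_ord m0 m1 m2 m3 i j k a b c.
Proof. rewrite /line_ord; apply/idP/idP; lia. Qed.
End Mono.

Lemma rmorph_line_prod (A S : comNzRingType) (f : {rmorphism A -> S}) n x y z i j k a b c :
  f (line_prod n x y z i j k a b c) = line_prod n (f x) (f y) (f z) i j k a b c.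
Proof. by rewrite /line_prod !rmorphM !rmorphXn !rmorphB !rmorphXn. Qed.

Section Step.
Variables (A : comNzRingType) (n : nat).
Hypothesis n3 : (3 <= n)%N.

(** The situation of one induction step on the power of the ideal, with [P] and
    [Q] in the roles of the [r]-th and [r+1]-st powers.  It is kept abstract so
    as to be invariant under the rotation of the variables. *)
Record peel (r D : nat) (x y z : A) (P Q : A -> Prop) : Prop := Peel {
  peelP : forall i j k a b c, line_ord n r r r r i j k a b c ->
      line_deg n i j k a b c = D -> P (line_prod n x y z i j k a b c);
  peelD : forall f g, Q f -> Q g -> Q (f + g);
  peelN : forall f, Q f -> Q (- f);
  peelx : forall f, P f -> Q (x * (y ^+ n - z ^+ n) * f);
  peely : forall f, P f -> Q (y * (z ^+ n - x ^+ n) * f);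
  peelz : forall f, P f -> Q (z * (x ^+ n - y ^+ n) * f) }.

Lemma peel_rot r D x y z P Q : peel r D x y z P Q -> peel r D y z x P Q.
Proof.
case=> hP hD hN hx hy hz; split=> // i j k a b c.
rewrite (line_prod_rot n x y z k i j c a b) => o d.
by apply: hP; move: o d; rewrite /line_ord /line_deg; lia.
Qed.

Ltac arith := solve [assumption
  | unfold line_ord, line_deg in *; lia | unfold line_ord, line_deg in *; nia].

Section Peel.
Variables (r D : nat) (x y z : A) (P Q : A -> Prop).
Hypothesis pl : peel r D x y z P Q.
Local Notation M := (line_prod n x y z).
Local Notation ok := (line_ord n r.+1 r.+1 r.+1 r.+1).
Local Notation dg i j k a b c := (line_deg n i j k a b c = (D + n.+1)%N).

(** Dividing by x A lowers the order at (1 : 0 : 0) by [n], but the orders at the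
    other three points only by one.  So a factor can be taken out exactly when
    the order at (1 : 0 : 0) exceeds its bound [r+1] by at least [n-1]:
    below, this is called having room at that point. *)
Lemma factor_x i j k a b c : ok i j k a b c -> dg i j k a b c ->
  (0 < i)%N -> (0 < a)%N -> (r + n <= n * a + j + k)%N -> Q (M i j k a b c).
Proof.
case: i => // i; case: a => // a o d _ _ h.
have -> : M i.+1 j k a.+1 b c = x * (y ^+ n - z ^+ n) * M i j k a b c.
  by rewrite /line_prod !exprS; ring.
apply: (peelx pl); apply: (peelP pl); move: o d h; rewrite /line_ord /line_deg; lia.
Qed.
End Peel.

Section Peel2.
Variables (r D : nat) (x y z : A) (P Q : A -> Prop).
Hypothesis pl : peel r D x y z P Q.
Local Notation M := (line_prod n x y z).
Local Notation ok := (line_ord n r.+1 r.+1 r.+1 r.+1).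
Local Notation dg i j k a b c := (line_deg n i j k a b c = (D + n.+1)%N).

Lemma factor_y i j k a b c : ok i j k a b c -> dg i j k a b c ->
  (0 < j)%N -> (0 < b)%N -> (r + n <= n * b + i + k)%N -> Q (M i j k a b c).
Proof.
rewrite -line_prod_rot => o d *.
apply: (factor_x (peel_rot pl)) => //; move: o d; rewrite /line_ord /line_deg; lia.
Qed.

Lemma factor_z i j k a b c : ok i j k a b c -> dg i j k a b c ->
  (0 < k)%N -> (0 < c)%N -> (r + n <= n * c + i + j)%N -> Q (M i j k a b c).
Proof.
rewrite -line_prod_rot -line_prod_rot => o d *.
apply: (factor_x (peel_rot (peel_rot pl))) => //; move: o d; rewrite /line_ord /line_deg; lia.
Qed.

(** The relation C = - A - B moves [n] units of order from (0 : 0 : 1) to one of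
    the other coordinate points, which then has room. *)
Lemma swap_c i j k a b c : ok i j k a b c -> dg i j k a b c ->
  (0 < i)%N -> (0 < j)%N -> (0 < c)%N -> (r.+1 + n <= n * c + i + j)%N ->
  Q (M i j k a b c).
Proof.
case: c => // c o d i0 j0 _ h.
have -> : M i j k a b c.+1 = - M i j k a.+1 b c + - M i j k a b.+1 c.
  by rewrite /line_prod !exprS; ring.
apply: (peelD pl); apply: (peelN pl).
  by apply: (factor_x pl); arith.
by apply: factor_y; arith.
Qed.
End Peel2.

Section Peel3.
Variables (r D : nat) (x y z : A) (P Q : A -> Prop).
Hypothesis pl : peel r D x y z P Q.
Local Notation M := (line_prod n x y z).
Local Notation ok := (line_ord n r.+1 r.+1 r.+1 r.+1).
Local Notation dg i j k a b c := (line_deg n i j k a b c = (D + n.+1)%N).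

Lemma swap_a i j k a b c : ok i j k a b c -> dg i j k a b c ->
  (0 < j)%N -> (0 < k)%N -> (0 < a)%N -> (r.+1 + n <= n * a + j + k)%N ->
  Q (M i j k a b c).
Proof.
rewrite -line_prod_rot => *; apply: (swap_c (peel_rot pl)); arith.
Qed.

Lemma swap_b i j k a b c : ok i j k a b c -> dg i j k a b c ->
  (0 < k)%N -> (0 < i)%N -> (0 < b)%N -> (r.+1 + n <= n * b + i + k)%N ->
  Q (M i j k a b c).
Proof.
rewrite -line_prod_rot -line_prod_rot => *.
apply: (swap_c (peel_rot (peel_rot pl))); arith.
Qed.

(** The relation X A = - Y B - Z C preserves the orders at all the points, and
    makes y B or z C available in place of x A. *)
Lemma trade_x i j k a b c : ok i j k a b c -> dg i j k a b c ->
  (n <= i)%N -> (0 < a)%N ->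
  (r + n <= n * b + i + k)%N -> (r + n <= n * c + i + j)%N ->
  Q (M i j k a b c).
Proof.
move=> o d hi; case: a o d => // a o d _ hb hc.
have -> : M i j k a.+1 b c =
    - M (i - n)%N (j + n)%N k a b.+1 c + - M (i - n)%N j (k + n)%N a b c.+1.
  have {1}-> : i = ((i - n) + n)%N by lia.
  by rewrite /line_prod !exprS !exprD; ring.
apply: (peelD pl); apply: (peelN pl).
  by apply: (factor_y pl); arith.
by apply: (factor_z pl); arith.
Qed.

(** If only the third point has room, then by the degree bound C occurs, so that
    the only obstacle is the absence of z together with that of x or y; the
    relations B = Z - X and A = Y - Z create these variables, and the degree
    bound ensures that there is a factor A or B to spare. *)
Lemma room_third i j k a b c : ok i j k a b c -> dg i j k a b c ->
  (r.+1 * n.+1 + 2 * n <= D + n.+1 + 3)%N ->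
  (n * a + j + k < r + n)%N -> (n * b + i + k < r + n)%N ->
  Q (M i j k a b c).
Proof.
move=> o d hD ha hb.
have c0 : (0 < c)%N by arith.
have hc : (r + n <= n * c + i + j)%N by arith.
case: (posnP k) => [k0|k0]; last by apply: (factor_z pl); arith.
subst k.
case: (posnP i) => [i0|i0]; last case: (posnP j) => [j0|j0].
- subst i.
  case: b => [|b] in o d hb *; first by arith.
  have hv : (r.+1 < a + b.+1 + c)%N by arith.
  have -> : M 0 j 0 a b.+1 c = M 0 j n a b c + - M n j 0 a b c.
    by rewrite /line_prod !exprS; ring.
  apply: (peelD pl); last apply: (peelN pl).
    by apply: (factor_z pl); arith.
  case: (posnP j) => [j0|j0]; last by apply: (swap_c pl); arith.
  subst j.
  case: a => [|a] in o d ha hv *; first by arith.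
  have -> : M n 0 0 a.+1 b c = M n n 0 a b c + - M n 0 n a b c.
    by rewrite /line_prod !exprS; ring.
  apply: (peelD pl); last apply: (peelN pl).
    by apply: (swap_c pl); arith.
  by apply: (factor_z pl); arith.
- subst j.
  case: a => [|a] in o d ha *; first by arith.
  have hv : (r.+1 < a.+1 + b + c)%N by arith.
  have -> : M i 0 0 a.+1 b c = M i n 0 a b c + - M i 0 n a b c.
    by rewrite /line_prod !exprS; ring.
  apply: (peelD pl); last apply: (peelN pl).
    by apply: (swap_c pl); arith.
  by apply: (factor_z pl); arith.
by apply: (swap_c pl); arith.
Qed.

(** If only the first point lacks room, it is enough to produce y B or z C, or a
    product to which [swap_b] or [swap_c] applies.  When y and z are both absent,
    either a factor A can be spared and A = Y - Z provides them, or x occurs to a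
    high power and x^n A is traded. *)
Lemma tight_first i j k a b c : ok i j k a b c -> dg i j k a b c ->
  (r.+1 * n.+1 + 2 * n <= D + n.+1 + 3)%N ->
  (n * a + j + k < r + n)%N -> (r + n <= n * b + i + k)%N ->
  (r + n <= n * c + i + j)%N -> Q (M i j k a b c).
Proof.
move=> o d hD ha hb hc.
case: (posnP j) => [j0|j0]; last first.
  case: (posnP b) => [b0|b0]; last by apply: (factor_y pl); arith.
  case: (posnP k) => [k0|k0]; last first.
    case: (posnP c) => [c0|c0]; last by apply: (factor_z pl); arith.
    by exfalso; arith.
  subst b k.
  case: (posnP a) => [a0|a0]; last by apply: (trade_x); arith.
  by apply: (swap_c pl); arith.
subst j; case: (posnP k) => [k0|k0]; last first.
  case: (posnP c) => [c0|c0]; last by apply: (factor_z pl); arith.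
  subst c; case: (posnP a) => [a0|a0]; last by apply: (trade_x); arith.
  by apply: swap_b; arith.
subst k.
case: (leqP (a + b + c)%N r.+1) => hv; first by apply: trade_x; arith.
case: a => [|a] in o d ha hv *; first by arith.
have -> : M i 0 0 a.+1 b c = M i n 0 a b c + - M i 0 n a b c.
  by rewrite /line_prod !exprS; ring.
apply: (peelD pl); last apply: (peelN pl).
  case: (posnP b) => [b0|b0]; last by apply: (factor_y pl); arith.
  by apply: (swap_c pl); arith.
case: (posnP c) => [c0|c0]; last by apply: (factor_z pl); arith.
by apply: swap_b; arith.
Qed.

(** If there is room everywhere, any of x A, y B, z C can be taken out, so the
    only products to be treated are those in which none of these occurs. *)
Lemma room_all i j k a b c : ok i j k a b c -> dg i j k a b c ->
  (r.+1 * n.+1 + 2 * n <= D + n.+1 + 3)%N ->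
  (r + n <= n * a + j + k)%N -> (r + n <= n * b + i + k)%N ->
  (r + n <= n * c + i + j)%N -> Q (M i j k a b c).
Proof.
move=> o d hD ha hb hc.
case: (posnP a) => [a0|a0]; case: (posnP b) => [b0|b0];
  case: (posnP c) => [c0|c0]; first by arith.
- case: (posnP k) => [k0|k0]; last by apply: (factor_z pl); arith.
  by apply: (swap_c pl); arith.
- case: (posnP j) => [j0|j0]; last by apply: (factor_y pl); arith.
  by apply: swap_b; arith.
- case: (posnP j) => [j0|j0]; last by apply: (factor_y pl); arith.
  case: (posnP k) => [k0|k0]; last by apply: (factor_z pl); arith.
  by exfalso; arith.
- case: (posnP i) => [i0|i0]; last by apply: (factor_x pl); arith.
  by apply: swap_a; arith.
- case: (posnP i) => [i0|i0]; last by apply: (factor_x pl); arith.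
  case: (posnP k) => [k0|k0]; last by apply: (factor_z pl); arith.
  by exfalso; arith.
- case: (posnP j) => [j0|j0]; last by apply: (factor_y pl); arith.
  case: (posnP i) => [i0|i0]; last by apply: (factor_x pl); arith.
  by exfalso; arith.
case: (posnP i) => [i0|i0]; last by apply: (factor_x pl); arith.
case: (posnP j) => [j0|j0]; last by apply: (factor_y pl); arith.
case: (posnP k) => [k0|k0]; last by apply: (factor_z pl); arith.
subst i j k.
have hv : (r.+1 < a + b + c)%N by arith.
case: a => [|a] in o d ha a0 hv *; first by arith.
have -> : M 0 0 0 a.+1 b c = M 0 n 0 a b c + - M 0 0 n a b c.
  by rewrite /line_prod !exprS; ring.
apply: (peelD pl); last apply: (peelN pl).
  by apply: (factor_y pl); arith.
by apply: (factor_z pl); arith.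
Qed.
End Peel3.

(** At least one of the three coordinate points has room: if not, adding up the
    three orders would contradict the bound on the degree. *)
Lemma line_prod_peel r D x y z P Q i j k a b c : peel r D x y z P Q ->
  line_ord n r.+1 r.+1 r.+1 r.+1 i j k a b c ->
  line_deg n i j k a b c = (D + n.+1)%N ->
  (r.+1 * n.+1 + 2 * n <= D + n.+1 + 3)%N ->
  Q (line_prod n x y z i j k a b c).
Proof.
move=> pl o d hD.
have pl1 := peel_rot pl; have pl2 := peel_rot pl1.
have o1 : line_ord n r.+1 r.+1 r.+1 r.+1 j k i b c a by rewrite line_ord_rot.
have o2 : line_ord n r.+1 r.+1 r.+1 r.+1 k i j c a b by rewrite line_ord_rot.
have d1 : line_deg n j k i b c a = (D + n.+1)%N by move: d; rewrite /line_deg; lia.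
have d2 : line_deg n k i j c a b = (D + n.+1)%N by move: d; rewrite /line_deg; lia.
have e1 := line_prod_rot n x y z i j k a b c.
have e2 : line_prod n z x y k i j c a b = line_prod n x y z i j k a b c.
  by rewrite line_prod_rot.
case: (leqP (r + n) (n * a + j + k)%N) => ha;
  case: (leqP (r + n) (n * b + i + k)%N) => hb;
  case: (leqP (r + n) (n * c + i + j)%N) => hc.
- exact: (room_all pl).
- by rewrite -e2; apply: (tight_first pl2) => //; lia.
- by rewrite -e1; apply: (tight_first pl1) => //; lia.
- by rewrite -e1; apply: (room_third pl1) => //; lia.
- exact: (tight_first pl).
- by rewrite -e2; apply: (room_third pl2) => //; lia.
- exact: (room_third pl).
exfalso; move: o d hD ha hb hc; rewrite /line_ord /line_deg; nia.
Qed.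
End Step.

(** * Ideals and their powers *)

Section Ideals.
Variable A : comNzRingType.
Implicit Types (I J S : set A).

Lemma ideal_gen_ideal S : is_ideal (ideal_gen S).
Proof.
split.
- by move=> J [[]].
- move=> f g hf hg J hJ; have [[_ hD _] _] := hJ.
  by apply: hD; [exact: hf|exact: hg].
- move=> a f hf J hJ; have [[_ _ hM] _] := hJ.
  by apply: hM; exact: hf.
Qed.

Lemma ideal_gen_sub S J : is_ideal J -> S `<=` J -> ideal_gen S `<=` J.
Proof. by move=> iJ SJ f; apply. Qed.

Lemma sub_ideal_gen S : S `<=` ideal_gen S.
Proof. by move=> f Sf J [_]; apply. Qed.

Lemma ideal0 J : is_ideal J -> J 0. Proof. by case. Qed.
Lemma idealD J f g : is_ideal J -> J f -> J g -> J (f + g).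
Proof. by case=> _ + _; apply. Qed.
Lemma idealMl J a f : is_ideal J -> J f -> J (a * f).
Proof. by case=> _ _; apply. Qed.
Lemma idealMr J a f : is_ideal J -> J f -> J (f * a).
Proof. by rewrite mulrC; exact: idealMl. Qed.
Lemma idealN J f : is_ideal J -> J f -> J (- f).
Proof. by move=> iJ Jf; rewrite -mulN1r; exact: idealMl. Qed.
Lemma idealB J f g : is_ideal J -> J f -> J g -> J (f - g).
Proof. by move=> iJ Jf Jg; apply: idealD => //; apply: idealN. Qed.
Lemma ideal_sum (T : Type) (r : seq T) (p : pred T) (F : T -> A) J :
  is_ideal J -> (forall t, p t -> J (F t)) -> J (\sum_(t <- r | p t) F t).
Proof.
move=> iJ h; apply: (big_ind J) => //; first exact: ideal0.
by move=> *; apply: idealD.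
Qed.

Lemma ideal_pow_ideal I m : is_ideal (ideal_pow I m).
Proof. exact: ideal_gen_ideal. Qed.
Hint Resolve ideal_pow_ideal : core.

Lemma colon_ideal J u : is_ideal J -> is_ideal [set f | J (u * f)].
Proof.
move=> iJ; split=> /=.
- by rewrite mulr0; exact: ideal0.
- by move=> f g hf hg; rewrite mulrDr; exact: idealD.
- by move=> a f hf; rewrite mulrCA; exact: idealMl.
Qed.

(** Powers of [I] are bounded above by any filtration by ideals that
    multiplication by elements of [I] raises. *)
Lemma ideal_pow_sub (I : set A) (F : nat -> set A) m :
  (forall d, is_ideal (F d)) -> F 0%N 1 ->
  (forall d f g, I f -> F d g -> F d.+1 (f * g)) ->
  ideal_pow I m `<=` F m.
Proof.
move=> iF F0 FS; apply: (ideal_gen_sub (iF m)) => _ [g Ig ->].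
elim: m g Ig => [|m IH] g Ig; first by rewrite big_ord0.
by rewrite big_ord_recl; apply: FS => //; apply: IH => i.
Qed.

Lemma ideal_pow0 I f : ideal_pow I 0 f.
Proof.
rewrite -[f]mulr1; apply: (idealMl _ (ideal_pow_ideal I 0)).
apply: sub_ideal_gen.
by exists (fun=> 0) => [[]|] //; rewrite big_ord0.
Qed.

Lemma ideal_powMI I m f g :
  I f -> ideal_pow I m g -> ideal_pow I m.+1 (f * g).
Proof.
move=> If; move: g.
apply: (ideal_gen_sub (J := [set g | ideal_pow I m.+1 (f * g)])).
  exact: colon_ideal.
move=> _ [g Ig ->] /=; apply: sub_ideal_gen.
exists (fun i => oapp g f (unlift ord0 i)); last first.
  rewrite big_ord_recl unlift_none; congr (_ * _).
  by apply: eq_bigr => i _; rewrite liftK.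
by move=> i; case: (unliftP ord0 i) => [j|] _ /=; [exact: Ig|exact: If].
Qed.

Lemma ideal_pow1 I f : I f -> ideal_pow I 1 f.
Proof.
by move=> If; rewrite -[f]mulr1; apply: ideal_powMI => //; exact: ideal_pow0.
Qed.

Lemma ideal_powM I a b f g :
  ideal_pow I a f -> ideal_pow I b g -> ideal_pow I (a + b) (f * g).
Proof.
move=> hf hg; rewrite mulrC; move: f hf.
pose F d : set A := [set f | ideal_pow I (d + b) (g * f)].
apply: (ideal_pow_sub (F := F)) => [d||d f h If] /=.
- exact: colon_ideal.
- by rewrite /F /= mulr1.
- by rewrite /F /= mulrCA addSn; exact: ideal_powMI.
Qed.

Lemma ideal_powX I a f k : ideal_pow I a f -> ideal_pow I (k * a) (f ^+ k).
Proof.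
move=> hf; elim: k => [|k IH]; first exact: ideal_pow0.
by rewrite mulSn exprS; exact: ideal_powM.
Qed.

Lemma ideal_pow_le I a b : (a <= b)%N -> ideal_pow I b `<=` ideal_pow I a.
Proof.
move=> /subnK <-; elim: (b - a)%N => [|d IH] // f hf; apply: IH; move: f hf.
rewrite addSn.
apply: (ideal_pow_sub (F := fun d => ideal_pow I d.-1)) => [//||[|e] f g If].
- exact: ideal_pow0.
- by move=> _; exact: ideal_pow0.
- exact: ideal_powMI.
Qed.
End Ideals.
#[global] Hint Resolve ideal_pow_ideal ideal_gen_ideal : core.

Section FermatIdeal.
Variables (A : comNzRingType) (n : nat).
Hypothesis n3 : (3 <= n)%N.
Variables (x y z : A).

Definition fermat : set A :=
  ideal_gen [set x * (y ^+ n - z ^+ n); y * (z ^+ n - x ^+ n);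
                 z * (x ^+ n - y ^+ n)].

Lemma fermat_x : fermat (x * (y ^+ n - z ^+ n)).
Proof. by apply: sub_ideal_gen; left; left. Qed.
Lemma fermat_y : fermat (y * (z ^+ n - x ^+ n)).
Proof. by apply: sub_ideal_gen; left; right. Qed.
Lemma fermat_z : fermat (z * (x ^+ n - y ^+ n)).
Proof. by apply: sub_ideal_gen; right. Qed.

Lemma fermat_sub J : is_ideal J -> J (x * (y ^+ n - z ^+ n)) ->
  J (y * (z ^+ n - x ^+ n)) -> J (z * (x ^+ n - y ^+ n)) -> fermat `<=` J.
Proof.
by move=> iJ hx hy hz; apply: (ideal_gen_sub iJ) => f [[|]|] ->.
Qed.

Lemma peel_fermat r D :
  (forall i j k a b c, line_ord n r r r r i j k a b c ->
     line_deg n i j k a b c = D -> ideal_pow fermat r (line_prod n x y z i j k a b c)) ->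
  peel n r D x y z (ideal_pow fermat r) (ideal_pow fermat r.+1).
Proof.
move=> h; split=> //.
- by move=> f g; apply: (idealD (ideal_pow_ideal fermat r.+1)).
- by move=> f; apply: (idealN (ideal_pow_ideal fermat r.+1)).
- by move=> *; apply: ideal_powMI => //; exact: fermat_x.
- by move=> *; apply: ideal_powMI => //; exact: fermat_y.
- by move=> *; apply: ideal_powMI => //; exact: fermat_z.
Qed.

Lemma line_prod_fermat_pow r i j k a b c : line_ord n r r r r i j k a b c ->
  (r * n.+1 + 2 * n <= line_deg n i j k a b c + 3)%N ->
  ideal_pow fermat r (line_prod n x y z i j k a b c).
Proof.
elim: r i j k a b c => [|r IH] i j k a b c o d; first exact: ideal_pow0.
have /subnK hD : (n.+1 <= line_deg n i j k a b c)%N by nia.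
apply: (line_prod_peel (D := (line_deg n i j k a b c - n.+1)%N) n3 _ o) => //.
  apply: peel_fermat => i' j' k' a' b' c' o' d'; apply: IH => //.
  by rewrite d'; nia.
by rewrite hD.
Qed.

(** For the first power the bound on the degree can be dropped, because the
    cofactors of the generators are then subject to no condition. *)
Lemma line_prod_fermat i j k a b c : line_ord n 1 1 1 1 i j k a b c ->
  fermat (line_prod n x y z i j k a b c).
Proof.
move=> o; have iF : is_ideal fermat by exact: ideal_gen_ideal.
have fx i' j' k' a' b' c' : (0 < i')%N -> (0 < a')%N ->
    fermat (line_prod n x y z i' j' k' a' b' c').
  case: i' => // i'; case: a' => // a' _ _.
  have -> : line_prod n x y z i'.+1 j' k' a'.+1 b' c' =
      line_prod n x y z i' j' k' a' b' c' * (x * (y ^+ n - z ^+ n)).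
    by rewrite /line_prod !exprS; ring.
  by apply: (idealMl _ iF); exact: fermat_x.
have fy i' j' k' a' b' c' : (0 < j')%N -> (0 < b')%N ->
    fermat (line_prod n x y z i' j' k' a' b' c').
  case: j' => // j'; case: b' => // b' _ _.
  have -> : line_prod n x y z i' j'.+1 k' a' b'.+1 c' =
      line_prod n x y z i' j' k' a' b' c' * (y * (z ^+ n - x ^+ n)).
    by rewrite /line_prod !exprS; ring.
  by apply: (idealMl _ iF); exact: fermat_y.
have fz i' j' k' a' b' c' : (0 < k')%N -> (0 < c')%N ->
    fermat (line_prod n x y z i' j' k' a' b' c').
  case: k' => // k'; case: c' => // c' _ _.
  have -> : line_prod n x y z i' j' k'.+1 a' b' c'.+1 =
      line_prod n x y z i' j' k' a' b' c' * (z * (x ^+ n - y ^+ n)).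
    by rewrite /line_prod !exprS; ring.
  by apply: (idealMl _ iF); exact: fermat_z.
case: (posnP (i * a)%N) => [ia|]; last by rewrite muln_gt0 => /andP[]; apply: fx.
case: (posnP (j * b)%N) => [jb|]; last by rewrite muln_gt0 => /andP[]; apply: fy.
case: (posnP (k * c)%N) => [kc|]; last by rewrite muln_gt0 => /andP[]; apply: fz.
have o' := o; rewrite /line_ord in o'.
case: (posnP a) => [a0|a0].
  case: (posnP b) => [b0|b0].
    have [c' Ec] : exists c', c = c'.+1 by exists c.-1; nia.
    subst a b c.
    have -> : line_prod n x y z i j k 0 0 c'.+1 =
        - line_prod n x y z i j k 1 0 c' - line_prod n x y z i j k 0 1 c'.
      by rewrite /line_prod !exprS; ring.
    apply: (idealB iF); first apply: (idealN iF).
      by apply: fx => //; nia.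
    by apply: fy => //; nia.
  have [b' Eb] : exists b', b = b'.+1 by exists b.-1; nia.
  subst a b.
  have -> : line_prod n x y z i j k 0 b'.+1 c =
        - line_prod n x y z i j k 1 b' c - line_prod n x y z i j k 0 b' c.+1.
    by rewrite /line_prod !exprS; ring.
  apply: (idealB iF); first apply: (idealN iF).
    by apply: fx => //; nia.
  by apply: fz => //; nia.
have [a' Ea] : exists a', a = a'.+1 by exists a.-1; nia.
subst a.
case: (posnP b) => [b0|b0].
  have -> : line_prod n x y z i j k a'.+1 b c =
        - line_prod n x y z i j k a' b.+1 c - line_prod n x y z i j k a' b c.+1.
    by rewrite /line_prod !exprS; ring.
  apply: (idealB iF); first apply: (idealN iF).
    by apply: fy => //; nia.
  by apply: fz => //; nia.
have -> : line_prod n x y z i j k a'.+1 b c =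
        line_prod n x y z i (j + n) k a' b c - line_prod n x y z i j (k + n) a' b c.
  by rewrite /line_prod !exprS !exprD; ring.
apply: (idealB iF); first by apply: fy => //; nia.
by apply: fz => //; nia.
Qed.
End FermatIdeal.

(** * Polynomials in three variables *)

(** Multiplicity of a root, without assuming that the coefficients form a field. *)
Lemma dvd_XsubC_cancel (D : idomainType) (a : D) m (p q r : {poly D}) :
  ('X - a%:P) ^+ m * r = p * q -> p.[a] != 0 ->
  exists q', q = ('X - a%:P) ^+ m * q'.
Proof.
elim: m q r => [|m IH] q r e pa; first by exists q; rewrite expr0 mul1r.
have : (p * q).[a] = 0.
  by rewrite -e exprS -mulrA hornerM hornerXsubC subrr mul0r.
rewrite hornerM => /eqP; rewrite mulf_eq0 (negPf pa) /= => /factor_theorem[q1 eq1].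
have e1 : ('X - a%:P) ^+ m * r = p * q1.
  apply: (@mulIf _ ('X - a%:P)); first by rewrite polyXsubC_eq0.
  by rewrite -(mulrA p) -eq1 -e exprS; ring.
have [q2 eq2] := IH _ _ e1 pa.
by exists q2; rewrite eq1 eq2 exprS; ring.
Qed.

Lemma mono_shuffle (S : comNzRingType) (a b c p q r : S) :
  a * p * (b * q) * (c * r) = a * b * c * (p * q * r).
Proof. by ring. Qed.

Section Ev.
Variables (K : fieldType).
Local Notation Rg := {mpoly K[3]}.
Definition i0 : 'I_3 := inord 0.
Definition i1 : 'I_3 := inord 1.
Definition i2 : 'I_3 := inord 2.
Local Notation x := ('X_i0 : Rg).
Local Notation y := ('X_i1 : Rg).
Local Notation z := ('X_i2 : Rg).

Section S.
Variables (S : comNzRingType) (f : {rmorphism K -> S}) (a b c : S).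
Fact eval3_key : unit. Proof. exact: tt. Qed.
(** Substitution for the three variables.  The body is locked, since conversion
    would otherwise unfold the substitutions built on it. *)
Definition eval3 : Rg -> S :=
  locked_with eval3_key (mmap f (fun i : 'I_3 => [:: a; b; c]`_i)).

Fact eval3_is_zmod_morphism : zmod_morphism eval3.
Proof. by rewrite /eval3 unlock => p q; rewrite mmapB. Qed.
Fact eval3_is_monoid_morphism : monoid_morphism eval3.
Proof.
by rewrite /eval3 unlock; split=> [|p q]; rewrite ?rmorph1 ?rmorphM.
Qed.
HB.instance Definition _ :=
  GRing.isZmodMorphism.Build Rg S eval3 eval3_is_zmod_morphism.
HB.instance Definition _ :=
  GRing.isMonoidMorphism.Build Rg S eval3 eval3_is_monoid_morphism.

Lemma eval3x : eval3 x = a.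
Proof. by rewrite /eval3 unlock mmapX mmap1U inordK. Qed.
Lemma eval3y : eval3 y = b.
Proof. by rewrite /eval3 unlock mmapX mmap1U inordK. Qed.
Lemma eval3z : eval3 z = c.
Proof. by rewrite /eval3 unlock mmapX mmap1U inordK. Qed.
Lemma eval3C k : eval3 k%:MP = f k.
Proof. by rewrite /eval3 unlock mmapC. Qed.
Definition eval3E := (eval3x, eval3y, eval3z, eval3C).
End S.

Lemma mpolyX3 (m : 'X_{1..3}) :
  'X_[m] = x ^+ m i0 * y ^+ m i1 * z ^+ m i2.
Proof.
rewrite mpolyXE_id !big_ord_recl big_ord0 mulr1 mulrA.
have -> : lift ord0 (lift ord0 ord0) = i2 by apply/val_inj; rewrite /= inordK.
have -> : lift ord0 ord0 = i1 by apply/val_inj; rewrite /= inordK.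
by have -> : ord0 = i0 by apply/val_inj; rewrite /= inordK.
Qed.

Lemma mpoly3_ind (P : Rg -> Prop) : (forall k, P k%:MP) -> P x -> P y -> P z ->
  (forall p q, P p -> P q -> P (p + q)) ->
  (forall p q, P p -> P q -> P (p * q)) -> forall p, P p.
Proof.
move=> hC hx hy hz hD hM; have hX p i : P p -> P (p ^+ i).
  move=> hp; elim: i => [|i IH]; last by rewrite exprS; apply: hM.
  by rewrite expr0 -mpolyC1.
elim/mpolyind => [|c m p _ _ hp]; first by rewrite -mpolyC0.
apply: hD => //; rewrite -mul_mpolyC mpolyX3.
by apply: (hM _ _ (hC c)); apply: (hM); first apply: (hM); apply: hX.
Qed.

Lemma mpoly3_span (P : Rg -> Prop) p : P 0 -> (forall q r, P q -> P r -> P (q + r)) ->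
  (forall m, p@_m != 0 -> P (p@_m *: (x ^+ m i0 * y ^+ m i1 * z ^+ m i2))) -> P p.
Proof.
move=> h0 hD h; rewrite (mpolyE p) big_seq; apply: (big_ind P) => // m.
by rewrite mcoeff_msupp mpolyX3; apply: h.
Qed.

Lemma rmorph_mpoly3_eq (S : nzRingType) (f g : {rmorphism Rg -> S}) :
  (forall k, f k%:MP = g k%:MP) -> f x = g x -> f y = g y -> f z = g z -> f =1 g.
Proof.
move=> hC hx hy hz; apply: mpoly3_ind => // p q hp hq.
  by rewrite !rmorphD hp hq.
by rewrite !rmorphM hp hq.
Qed.

Lemma rmorph_mono (S : nzRingType) (f : {rmorphism Rg -> S}) c i j k :
  f (c *: (x ^+ i * y ^+ j * z ^+ k)) = f c%:MP * (f x ^+ i * f y ^+ j * f z ^+ k).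
Proof. by rewrite -mul_mpolyC !rmorphM !rmorphXn. Qed.

(** A substitution changes a polynomial by an element of any ideal that contains
    the changes of the variables. *)
Lemma subst_congr (J : set Rg) (f : {rmorphism Rg -> Rg}) : is_ideal J ->
  (forall k, f k%:MP = k%:MP) -> J (x - f x) -> J (y - f y) -> J (z - f z) ->
  forall p, J (p - f p).
Proof.
move=> iJ hC hx hy hz; apply: mpoly3_ind => // [k|p q hp hq|p q hp hq].
- by rewrite hC subrr; exact: ideal0.
- by rewrite rmorphD opprD addrACA; exact: idealD.
rewrite rmorphM.
have -> : p * q - f p * f q = p * (q - f q) + f q * (p - f p) by ring.
by apply: (idealD iJ); apply: (idealMl _ iJ).
Qed.

Section Weight.
Variables (u v w : nat).
Definition weight (m : 'X_{1..3}) : nat := (u * m i0 + v * m i1 + w * m i2)%N.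
(** The variables are multiplied by powers of a new variable T, so that the
    coefficient of T^d is the part of weight d.  The order of vanishing at a
    coordinate point and the degree are both weights, and statements about them
    become divisibility by powers of T. *)
Definition grade : Rg -> {poly Rg} :=
  eval3 (polyC \o @mpolyC 3 K) (x%:P * 'X^u) (y%:P * 'X^v) (z%:P * 'X^w).
HB.instance Definition _ := GRing.RMorphism.copy grade
  (eval3 (polyC \o @mpolyC 3 K) (x%:P * 'X^u) (y%:P * 'X^v) (z%:P * 'X^w)).

Lemma gradex : grade x = x%:P * 'X^u. Proof. exact: eval3x. Qed.
Lemma gradey : grade y = y%:P * 'X^v. Proof. exact: eval3y. Qed.
Lemma gradez : grade z = z%:P * 'X^w. Proof. exact: eval3z. Qed.
Lemma gradeC k : grade k%:MP = k%:MP%:P. Proof. exact: eval3C. Qed.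
Definition gradeE := (gradex, gradey, gradez, gradeC).

Lemma gradeX m : grade 'X_[m] = 'X_[m]%:P * 'X^(weight m).
Proof.
rewrite mpolyX3 !rmorphM !rmorphXn /= !gradeE !exprMn -!exprM /weight !exprD.
exact: mono_shuffle.
Qed.

Lemma grade_coef p d m :
  ((grade p)`_d)@_m = if weight m == d then p@_m else 0.
Proof.
elim/mpolyind: p => [|c m' p _ _ IH].
  by rewrite rmorph0 coef0 !mcoeff0 if_same.
rewrite rmorphD -mul_mpolyC rmorphM /= gradeC gradeX coefD mcoeffD IH.
rewrite mulrA -polyCM coefCM coefXn mcoeffD mcoeffCM.
case: (eqVneq (weight m) d) => [<-|nd].
  case: (eqVneq (weight m) (weight m')) => [e|ne].
    by rewrite mulr1 mcoeffCM.
  have /negPf m'm : m' != m by apply: contraNneq ne => ->.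
  by rewrite mulr0 mcoeff0 mcoeffX m'm mulr0.
case: (eqVneq d (weight m')) => [e|ne]; last by rewrite mulr0 mcoeff0 addr0.
have /negPf m'm : m' != m by apply: contraNneq nd => <-; rewrite e.
by rewrite mulr1 mcoeffCM mcoeffX m'm mulr0 addr0.
Qed.

Definition order_ge (l : nat) (p : Rg) := forall m, p@_m != 0 -> (l <= weight m)%N.

Lemma order_geP l p : order_ge l p <-> exists q, grade p = 'X^l * q.
Proof.
split=> [h|[q e] m].
  exists (drop_poly l (grade p)).
  rewrite -{1}(poly_take_drop l (grade p)) mulrC.
  suff -> : take_poly l (grade p) = 0 by rewrite add0r.
  apply/polyP => d; rewrite coef_take_poly coef0; case: ltnP => // ld.
  apply/mpolyP => m; rewrite grade_coef mcoeff0; case: eqP => // e.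
  by apply/eqP; apply: contraTT ld; rewrite -e -leqNgt; exact: h.
apply: contraTT; rewrite -ltnNge => lm; rewrite negbK; apply/eqP.
have := grade_coef p (weight m) m; rewrite eqxx => <-.
by rewrite e coefXnM lm mcoeff0.
Qed.

(** Orders are additive on products: if [p] has order exactly [e], then [p] can
    be cancelled at the cost of [e]. *)
Lemma order_ge_cancel l e p q q' : order_ge l (p * q) -> grade p = 'X^e * q' ->
  q'`_0 != 0 -> order_ge (l - e) q.
Proof.
move=> /order_geP[r]; rewrite rmorphM /= => e1 e2 h.
case: (leqP l e) => [|/ltnW le]; first by rewrite -subn_eq0 => /eqP -> m _.
have e3 : ('X - 0%:P) ^+ (l - e) * r = q' * grade q.
  rewrite subr0; apply: (@mulfI _ ('X^e : {poly Rg})).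
    by rewrite -size_poly_eq0 size_polyXn.
  by rewrite mulrA -exprD subnKC // mulrA -e2 e1.
apply/order_geP; have [|r' ->] := dvd_XsubC_cancel e3; last by exists r'; rewrite subr0.
by rewrite horner_coef0.
Qed.

Lemma order_ge_ideal l : is_ideal (order_ge l).
Proof.
split.
- by move=> m; rewrite mcoeff0 eqxx.
- move=> p q /order_geP[p' ep] /order_geP[q' eq]; apply/order_geP; exists (p' + q').
  by rewrite rmorphD /= ep eq mulrDr.
- move=> p q /order_geP[q' eq]; apply/order_geP; exists (grade p * q').
  by rewrite rmorphM /= eq mulrCA.
Qed.

Lemma order_geM l1 l2 p q : order_ge l1 p -> order_ge l2 q -> order_ge (l1 + l2) (p * q).
Proof.
move=> /order_geP[p' ep] /order_geP[q' eq]; apply/order_geP; exists (p' * q').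
by rewrite rmorphM /= ep eq exprD; ring.
Qed.

Lemma order_geX l p k : order_ge l p -> order_ge (k * l) (p ^+ k).
Proof.
move=> h; elim: k => [|k IH]; first by move=> m.
by rewrite exprS mulSn; exact: order_geM.
Qed.

Lemma order_ge_le l1 l2 p : (l1 <= l2)%N -> order_ge l2 p -> order_ge l1 p.
Proof. by move=> le h m /h; exact: leq_trans. Qed.

Lemma order_ge_ideal_pow (I : set Rg) l k : I `<=` order_ge l ->
  ideal_pow I k `<=` order_ge (k * l).
Proof.
move=> h; apply: (ideal_pow_sub (F := fun k => order_ge (k * l))).
- by move=> d; exact: order_ge_ideal.
- by move=> m.
- by move=> d f g /h; rewrite mulSn; exact: order_geM.
Qed.
End Weight.

Definition hom_deg (D : nat) (p : Rg) := forall m, p@_m != 0 -> weight 1 1 1 m = D.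

Lemma hom_degP D p : hom_deg D p <-> grade 1 1 1 p = p%:P * 'X^D.
Proof.
split=> [h|e m].
  apply/polyP => d; rewrite coefCM coefXn; apply/mpolyP => m.
  rewrite grade_coef; case: (eqVneq (p@_m) 0) => [e0|/h ->].
    by rewrite e0 if_same; case: (d == D); rewrite ?mulr1 ?mulr0 ?mcoeff0 ?e0.
  by rewrite eq_sym; case: (d == D); rewrite ?mulr1 ?mulr0 ?mcoeff0.
apply: contraNeq => nD.
have := grade_coef 1 1 1 p (weight 1 1 1 m) m; rewrite eqxx => <-.
by rewrite e coefCM coefXn (negPf nD) mulr0 mcoeff0.
Qed.

Lemma hom_deg0 D : hom_deg D 0.
Proof. by move=> m; rewrite mcoeff0 eqxx. Qed.
Lemma hom_degD D p q : hom_deg D p -> hom_deg D q -> hom_deg D (p + q).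
Proof.
move=> /hom_degP hp /hom_degP hq; apply/hom_degP.
by rewrite rmorphD /= hp hq polyCD mulrDl.
Qed.
Lemma hom_degZ D k p : hom_deg D p -> hom_deg D (k *: p).
Proof.
by move=> h m; rewrite mcoeffZ mulf_eq0 negb_or => /andP[_ /h].
Qed.
Lemma hom_degM D1 D2 p q : hom_deg D1 p -> hom_deg D2 q -> hom_deg (D1 + D2) (p * q).
Proof.
move=> /hom_degP hp /hom_degP hq; apply/hom_degP; rewrite rmorphM /= hp hq polyCM exprD; ring.
Qed.
Lemma hom_degX D p k : hom_deg D p -> hom_deg (k * D) (p ^+ k).
Proof.
move=> h; elim: k => [|k IH]; last by rewrite exprS mulSn; exact: hom_degM.
by apply/hom_degP; rewrite expr0 rmorph1 mulr1.
Qed.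

Lemma hom_deg_cancel D e p q : hom_deg e p -> p != 0 -> hom_deg D (p * q) -> q != 0 ->
  (e <= D)%N /\ hom_deg (D - e) q.
Proof.
move=> /hom_degP hp p0 /hom_degP; rewrite rmorphM /= hp polyCM => h q0.
have e1 : 'X^e * grade 1 1 1 q = q%:P * 'X^D.
  apply: (@mulfI _ p%:P); first by rewrite polyC_eq0.
  by move: h; rewrite -!mulrA.
have le : (e <= D)%N.
  rewrite leqNgt; apply/negP => lt.
  have := congr1 (fun r : {poly Rg} => r`_D) e1.
  rewrite coefXnM lt coefCM coefXn eqxx mulr1 => /esym/eqP.
  by rewrite (negPf q0).
split=> //; apply/hom_degP; apply: (@mulfI _ ('X^e : {poly Rg})).
  by rewrite -size_poly_eq0 size_polyXn.
by rewrite e1 mulrCA -exprD subnKC.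
Qed.

End Ev.

(** * Powers of an ideal with two generators *)

Section PowersOfTwoGenerators.
Variables (S : comNzRingType) (a b : S).

(** The powers of the ideal (a, b), in a form that separates the multiples of a
    from the power of b. *)
Fixpoint pair_pow (m : nat) : set S :=
  if m is m'.+1 then [set f | exists g h, f = b ^+ m * g + a * h /\ pair_pow m' h]
  else setT.

Lemma pair_pow_ideal m : is_ideal (pair_pow m).
Proof.
elim: m => [|m [IH0 IHD IHM]]; first by split.
split.
- by exists 0, 0; rewrite !mulr0 addr0.
- move=> _ _ [g [h [-> hh]]] [g' [h' [-> hh']]]; exists (g + g'), (h + h').
  by split; [rewrite !mulrDr addrACA|exact: IHD].
- move=> u _ [g [h [-> hh]]]; exists (u * g), (u * h).
  by split; [rewrite mulrDr !(mulrCA u)|exact: IHM].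
Qed.
Local Hint Resolve pair_pow_ideal : core.

Lemma pair_pow_bX m f : pair_pow m (b ^+ m * f).
Proof.
case: m => [|m] //=; exists f, 0; rewrite mulr0 addr0; split=> //.
exact: ideal0.
Qed.

Lemma pair_pow_a m f : pair_pow m f -> pair_pow m.+1 (a * f).
Proof. by move=> h; exists 0, f; rewrite mulr0 add0r. Qed.

Lemma pair_pow_b m f : pair_pow m f -> pair_pow m.+1 (b * f).
Proof.
elim: m f => [|m IH] f; first by move=> _; have := pair_pow_bX 1 f; rewrite expr1.
case=> g [h [-> hh]]; exists g, (b * h); split; last exact: IH.
by rewrite mulrDr mulrA -exprS mulrCA.
Qed.

Lemma pair_pow_c c m f : a + b + c = 0 -> pair_pow m f -> pair_pow m.+1 (c * f).
Proof.
move=> e h; have -> : c * f = - (a * f) - b * f.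
  have -> : c = (a + b + c) - a - b by ring.
  by rewrite e; ring.
apply: (idealB (pair_pow_ideal _)); last exact: pair_pow_b.
by apply: (idealN (pair_pow_ideal _)); exact: pair_pow_a.
Qed.

Lemma pair_pow_S m : pair_pow m.+1 `<=` pair_pow m.
Proof.
elim: m => [|m IH] // _ [g [h [-> hh]]].
exists (b * g), h; split; first by rewrite exprSr mulrA.
exact: IH.
Qed.

Lemma pair_pow_le i j : (i <= j)%N -> pair_pow j `<=` pair_pow i.
Proof.
move=> /subnK <-; elim: (j - i)%N => [|d IH] // f hf; apply: IH.
exact: pair_pow_S.
Qed.

Lemma pair_pow_mod_a m f : pair_pow m f -> exists g h, f = b ^+ m * g + a * h.
Proof.
case: m => [_|m [g [h [-> _]]]]; last by exists g, h.
by exists f, 0; rewrite mulr0 addr0 mul1r.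
Qed.
End PowersOfTwoGenerators.

Section FermatPairPow.
Variables (S : comNzRingType) (n : nat) (x y z : S).
Local Notation J := (pair_pow (y ^+ n - z ^+ n) (z ^+ n - x ^+ n)).

Lemma pair_pow_line_prod i j k a b c : J (a + b + c) (line_prod n x y z i j k a b c).
Proof.
have e : y ^+ n - z ^+ n + (z ^+ n - x ^+ n) + (x ^+ n - y ^+ n) = 0 by ring.
apply: (idealMl _ (pair_pow_ideal _ _ _)).
have hc : J c ((x ^+ n - y ^+ n) ^+ c).
  by elim: c => [|c IH] //; rewrite exprS; exact: pair_pow_c.
have hb : J (b + c) ((z ^+ n - x ^+ n) ^+ b * (x ^+ n - y ^+ n) ^+ c).
  by elim: b => [|b IH]; rewrite ?mul1r // exprS -mulrA; exact: pair_pow_b.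
rewrite -mulrA -addnA; elim: a => [|a IH]; first by rewrite mul1r.
by rewrite exprS -mulrA; exact: pair_pow_a.
Qed.

Lemma fermat_pow_pair_pow m : ideal_pow (fermat n x y z) m `<=` J m.
Proof.
have e : y ^+ n - z ^+ n + (z ^+ n - x ^+ n) + (x ^+ n - y ^+ n) = 0 by ring.
apply: ideal_pow_sub => [d||d f g hf hg] //; first exact: pair_pow_ideal.
have mulJ u v : J d.+1 (v * g) -> J d.+1 (g * (u * v)).
  by rewrite mulrCA [g * _]mulrC; exact: (idealMl _ (pair_pow_ideal _ _ _)).
rewrite mulrC; move: f hf; apply: (fermat_sub (J := [set f | J d.+1 (g * f)])).
- by apply: colon_ideal; exact: pair_pow_ideal.
- by apply: mulJ; apply: pair_pow_a.
- by apply: mulJ; apply: pair_pow_b.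
- by apply: mulJ; apply: pair_pow_c.
Qed.
End FermatPairPow.

Definition full_roots (K : fieldType) (n : nat) (s : seq K) : Prop :=
  [/\ (3 <= n)%N, uniq s, size s = n & all (fun w => w ^+ n == 1) s].

Section Fermat.
Variables (K : fieldType) (n : nat) (s : seq K).
Hypothesis hs : full_roots n s.
Let n3 : (3 <= n)%N. Proof. by case: hs. Qed.
Let su : uniq s. Proof. by case: hs. Qed.
Let ss : size s = n. Proof. by case: hs. Qed.
Let s1 : all (fun w => w ^+ n == 1) s. Proof. by case: hs. Qed.

Local Notation Rg := {mpoly K[3]}.
Local Notation x := ('X_i0 : Rg).
Local Notation y := ('X_i1 : Rg).
Local Notation z := ('X_i2 : Rg).
Local Notation A := (y ^+ n - z ^+ n).
Local Notation B := (z ^+ n - x ^+ n).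

Let n_gt0 : (0 < n)%N. Proof. by apply: leq_trans n3. Qed.

(** The homogeneous form of the factorization of t^n - 1, obtained from it by
    putting t = a/b in the field of fractions. *)
Lemma prod_roots_of_unity (S : idomainType) (f : {rmorphism K -> S}) (a b : S) :
  \prod_(w <- s) (a - f w * b) = a ^+ n - b ^+ n.
Proof.
case: (eqVneq b 0) => [->|b0].
  rewrite expr0n gtn_eqF ?n_gt0 // subr0.
  under eq_bigr do rewrite mulr0 subr0.
  by rewrite big_const_seq count_predT ss iter_mulr_1.
have XE : \prod_(w <- s) ('X - w%:P) = 'X^n - 1.
  have h : size ('X^n - 1 : {poly K}) = (size s).+1 by rewrite size_XnsubC ?n_gt0 ?ss.
  rewrite (all_roots_prod_XsubC h) ?uniq_rootsE //.
    by rewrite (eqP (monicXnsubC 1 n_gt0)) scale1r.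
  by apply/allP => w ws; rewrite rootE !hornerE subr_eq0; apply: (allP s1).
apply/eqP; rewrite -tofrac_eq; apply/eqP; rewrite rmorph_prod /= rmorphB !rmorphXn /=.
have b1 : tofrac b != 0 by rewrite tofrac_eq0.
pose g : {rmorphism K -> {fraction S}} := (@tofrac S \o f).
pose t := tofrac a / tofrac b.
have ta : tofrac a = t * tofrac b by rewrite /t divfK.
transitivity (\prod_(w <- s) ((t - g w) * tofrac b)).
  by apply: eq_bigr => w _; rewrite rmorphB rmorphM /= ta mulrBl.
rewrite big_split /= big_const_seq count_predT ss iter_mulr_1 ta exprMn.
rewrite -[X in _ - X]mul1r -mulrBl.
congr (_ * _).
have := congr1 (fun p => (map_poly g p).[t]) XE.
rewrite rmorph_prod /= horner_prod rmorphB /= map_polyXn rmorph1 !hornerE => <-.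
by apply: eq_bigr => w _; rewrite rmorphB /= map_polyX map_polyC !hornerE.
Qed.

(** Restriction to the line y = e z; these lines are the components of A when
    [e] runs through the roots of unity. *)
Definition on_line (e : K) : Rg -> Rg := eval3 (@mpolyC 3 K) x (e%:MP * z) z.
HB.instance Definition _ e := GRing.RMorphism.copy (on_line e)
  (eval3 (@mpolyC 3 K) x (e%:MP * z) z).

Lemma on_lineE e : (on_line e x = x) * (on_line e y = e%:MP * z) * (on_line e z = z)
  * (forall k, on_line e k%:MP = k%:MP).
Proof. by rewrite /on_line !eval3E; do !split=> // k; rewrite eval3E. Qed.

Lemma mpolyX_neq0 i : ('X_i : Rg) != 0.
Proof.
apply/eqP => /(congr1 (fun p : Rg => p@_U_(i))).
by rewrite mcoeffX mcoeff0 eqxx => /eqP; rewrite oner_eq0.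
Qed.

Lemma lines_dvd (l : seq K) (f : Rg) : uniq l ->
  (forall e, e \in l -> on_line e f = 0) ->
  exists g, f = \prod_(e <- l) (y - e%:MP * z) * g.
Proof.
elim: l f => [|e l IH] f /=; first by exists f; rewrite big_nil mul1r.
move=> /andP[el ul] h.
pose J : set Rg := [set p | exists q, p = (y - e%:MP * z) * q].
have iJ : is_ideal J.
  split; first by exists 0; rewrite mulr0.
    by move=> _ _ [p ->] [q ->]; exists (p + q); rewrite mulrDr.
  by move=> a _ [q ->]; exists (a * q); rewrite mulrCA.
have /(_ f) : forall p, J (p - on_line e p).
  apply: subst_congr => // [k|||] /=; rewrite on_lineE ?subrr //.
  - exact: ideal0.
  - by exists 1; rewrite mulr1.
  - exact: ideal0.
rewrite h ?mem_head // subr0 => -[f1 ef].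
have [|g eg] := IH f1 ul.
  move=> e' e'l; have := h e'; rewrite inE e'l orbT => /(_ isT).
  rewrite ef rmorphM rmorphB rmorphM /= !on_lineE -mulrBl => /eqP.
  rewrite !mulf_eq0 (negPf (mpolyX_neq0 _)) orbF => /orP[|/eqP//].
  rewrite -rmorphB /= mpolyC_eq0 subr_eq0 => /eqP e'e.
  by rewrite -e'e e'l in el.
by exists g; rewrite ef eg big_cons mulrA.
Qed.

Lemma dvd_A (f : Rg) : (forall e, e \in s -> on_line e f = 0) -> exists g, f = A * g.
Proof.
move=> h; have [g ->] := lines_dvd su h.
by exists g; rewrite (prod_roots_of_unity (@mpolyC 3 K)).
Qed.

Lemma on_line_A e : e \in s -> on_line e A = 0.
Proof.
move=> es; rewrite rmorphB !rmorphXn /= !on_lineE exprMn -rmorphXn /=.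
by rewrite (eqP (allP s1 _ es)) mul1r subrr.
Qed.

Lemma on_line_B e : on_line e B = B.
Proof. by rewrite rmorphB !rmorphXn /= !on_lineE. Qed.

Lemma subXn_neq0 i j : i != j -> ('X_i ^+ n - 'X_j ^+ n : Rg) != 0.
Proof.
move=> ij; rewrite !mpolyXn subr_eq0; apply/eqP => /(congr1 (fun p : Rg => p@_(U_(i) *+ n))).
rewrite !mcoeffX eqxx; case: eqP => [e|_ /eqP]; last by rewrite oner_eq0.
have /(congr1 (fun m : 'X_{1..3} => m i)) := e.
by rewrite !mulmnE !mnmE eqxx eq_sym (negPf ij) mul0n mul1n => en; have := n_gt0; rewrite -en.
Qed.

Lemma A_neq0 : A != 0.
Proof. by apply: subXn_neq0; rewrite -val_eqE /= !inordK. Qed.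
Lemma B_neq0 : B != 0.
Proof. by apply: subXn_neq0; rewrite -val_eqE /= !inordK. Qed.

Local Notation J := (pair_pow A B).

(** If A f = B^m g + A h then A divides [g], since B does not vanish on any of the
    lines y = e z that make up A. *)
Lemma pair_pow_colonA m f : J m (A * f) -> J m.-1 f.
Proof.
case: m => [|m] //= -[g [h [e hh]]].
have e2 : A * (f - h) = B ^+ m.+1 * g by rewrite mulrBr e addrK.
have [|g' eg] := @dvd_A g.
  move=> w ws.
  move/(congr1 (on_line w)): (e2).
  rewrite rmorphM /= on_line_A // mul0r rmorphM rmorphXn /= on_line_B.
  by move/esym/eqP; rewrite mulf_eq0 expf_eq0 (negPf B_neq0) andbF /= => /eqP.
have e3 : f - h = B ^+ m * (B * g').
  by apply: (mulfI A_neq0); rewrite e2 eg exprSr -!mulrA [in RHS]mulrCA [A * (B * _)]mulrCA.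
have -> : f = B ^+ m * (B * g') + h by rewrite -e3 subrK.
by apply: (idealD (pair_pow_ideal _ _ _)) => //; exact: pair_pow_bX.
Qed.

End Fermat.

(** * Vanishing at the points with nonzero coordinates *)

Lemma div_shuffle (S : comNzRingType) (c xi X yj zk Z : S) :
  c * (xi * X * yj * zk) =
  c * (xi * yj * (zk * Z)) - (Z - X) * (c * (xi * yj * zk)).
Proof. by ring. Qed.

Lemma poly_mono (S : comNzRingType) (c u v : S) i j k :
  c%:P * ('X^i * u%:P ^+ j * v%:P ^+ k) = (c * (u ^+ j * v ^+ k))%:P * 'X^i.
Proof. by rewrite !polyCM !polyC_exp -[_ * _ * _]mulrA mulrCA [in RHS]mulrC. Qed.

Section Local.
Variables (K : fieldType) (n : nat) (s : seq K).
Hypothesis hs : full_roots n s.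
Let n3 : (3 <= n)%N. Proof. by case: hs. Qed.
Let su : uniq s. Proof. by case: hs. Qed.
Let ss : size s = n. Proof. by case: hs. Qed.
Let s1 : all (fun w => w ^+ n == 1) s. Proof. by case: hs. Qed.
Let n_gt0 : (0 < n)%N. Proof. exact: leq_trans n3. Qed.

Local Notation Rg := {mpoly K[3]}.
Local Notation x := ('X_i0 : Rg).
Local Notation y := ('X_i1 : Rg).
Local Notation z := ('X_i2 : Rg).
Local Notation A := (y ^+ n - z ^+ n).
Local Notation B := (z ^+ n - x ^+ n).
Local Notation J := (pair_pow A B).

Definition xpoly : Rg -> {poly Rg} :=
  eval3 (polyC \o @mpolyC 3 K) 'X y%:P z%:P.
HB.instance Definition _ := GRing.RMorphism.copy xpoly
  (eval3 (polyC \o @mpolyC 3 K) 'X y%:P z%:P).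

Lemma xpolyx : xpoly x = 'X. Proof. exact: eval3x. Qed.
Lemma xpolyy : xpoly y = y%:P. Proof. exact: eval3y. Qed.
Lemma xpolyz : xpoly z = z%:P. Proof. exact: eval3z. Qed.
Lemma xpolyC k : xpoly k%:MP = k%:MP%:P. Proof. exact: eval3C. Qed.
Definition xpolyE := (xpolyx, xpolyy, xpolyz, xpolyC).

Lemma xpoly_mono c i j k : xpoly (c *: (x ^+ i * y ^+ j * z ^+ k)) =
  (c%:MP * (y ^+ j * z ^+ k))%:P * 'X^i.
Proof. by rewrite rmorph_mono /= xpolyC xpolyx xpolyy xpolyz poly_mono. Qed.

Lemma size_xpoly_mono c i j k :
  (size (xpoly (c *: (x ^+ i * y ^+ j * z ^+ k))) <= i.+1)%N.
Proof.
rewrite xpoly_mono mul_polyC.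
by apply: leq_trans (size_scale_leq _ _) _; rewrite size_polyXn.
Qed.

Lemma size_xpoly N (f : Rg) :
  (forall m, f@_m != 0 -> (m i0 < N)%N) -> (size (xpoly f) <= N)%N.
Proof.
move=> h; apply: (mpoly3_span (P := fun f => (size (xpoly f) <= N)%N)).
- by rewrite rmorph0 size_poly0.
- move=> p q hp hq; rewrite rmorphD /=; apply: leq_trans (size_polyD _ _) _.
  by rewrite geq_max hp hq.
by move=> m /h hm; apply: leq_trans (size_xpoly_mono _ _ _ _) _.
Qed.

Lemma xpoly_B : xpoly B = (z ^+ n)%:P - 'X^n.
Proof. by rewrite rmorphB !rmorphXn /= !xpolyE. Qed.

Lemma size_xpoly_B : size (xpoly B) = n.+1.
Proof.
rewrite xpoly_B -opprB size_polyN; exact: size_XnsubC.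
Qed.

(** Up to sign, B is monic of degree [n] in x. *)
Lemma div_B f : exists g h, f = B * g + h /\ (size (xpoly h) <= n)%N.
Proof.
apply: (mpoly3_span (P := fun f => exists g h, f = B * g + h /\ (size (xpoly h) <= n)%N)).
- by exists 0, 0; rewrite rmorph0 mulr0 addr0 size_poly0.
- move=> _ _ [g [h [-> hh]]] [g' [h' [-> hh']]]; exists (g + g'), (h + h').
  split; first by rewrite mulrDr addrACA.
  rewrite rmorphD /=; apply: leq_trans (size_polyD _ _) _.
  by rewrite geq_max hh hh'.
move=> m _; move: (f@_m) (m i0) (m i1) (m i2) => c i j.
elim/ltn_ind: i j => i IH j k.
case: (ltnP i n) => [lt|ge].
  exists 0, (c *: (x ^+ i * y ^+ j * z ^+ k)); rewrite mulr0 add0r; split=> //.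
  exact: leq_trans (size_xpoly_mono _ _ _ _) _.
have [|g [h [e hh]]] := IH (i - n)%N _ j (k + n)%N; first by lia.
exists (g - c *: (x ^+ (i - n) * y ^+ j * z ^+ k)), h; split=> //.
rewrite mulrBr addrAC -e -{1}(subnK ge) !exprD -!mul_mpolyC.
exact: div_shuffle.
Qed.

Lemma div_BX m f : exists g h, f = B ^+ m * g + h /\ (size (xpoly h) <= n * m)%N.
Proof.
elim: m => [|m [g [h [-> hh]]]].
  by exists f, 0; rewrite rmorph0 size_poly0 expr0 mul1r addr0.
have [g' [h' [-> hh']]] := div_B g.
exists g', (B ^+ m * h' + h); split.
  by rewrite exprSr mulrDr mulrA addrA.
rewrite rmorphD rmorphM rmorphXn /=.
apply: leq_trans (size_polyD _ _) _; rewrite geq_max; apply/andP; split; last first.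
  by rewrite mulnS; apply: leq_trans hh (leq_addl _ _).
apply: leq_trans (size_polyMleq _ _) _.
have := size_poly_exp_leq (xpoly B) m; rewrite size_xpoly_B /=.
move: (size _) hh' => u; move: (size _) => v; nia.
Qed.

(** The points of the line through the origin that represents (w : e : 1), so
    that the kernel is the homogeneous prime ideal of this projective point. *)
Definition at_point (w e : K) : Rg -> {poly K} := eval3 (@polyC K) (w%:P * 'X) (e%:P * 'X) 'X.
HB.instance Definition _ w e := GRing.RMorphism.copy (at_point w e)
  (eval3 (@polyC K) (w%:P * 'X) (e%:P * 'X) 'X).

Lemma at_pointx w e : at_point w e x = w%:P * 'X. Proof. exact: eval3x. Qed.
Lemma at_pointy w e : at_point w e y = e%:P * 'X. Proof. exact: eval3y. Qed.
Lemma at_pointz w e : at_point w e z = 'X. Proof. exact: eval3z. Qed.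
Lemma at_pointC w e k : at_point w e k%:MP = k%:P. Proof. exact: eval3C. Qed.
Definition at_pointE := (at_pointx, at_pointy, at_pointz, at_pointC).

(** Membership in (A, B)^m locally at each of the [n^2] points. *)
Definition pair_local m (f : Rg) := forall w e, w \in s -> e \in s ->
  exists t, at_point w e t != 0 /\ J m (t * f).

Lemma pair_pow_pair_local m f : J m f -> pair_local m f.
Proof.
move=> h w e _ _; exists 1; rewrite rmorph1 oner_neq0; split=> //.
by rewrite mul1r.
Qed.

Lemma xpoly_on_line e f : (map_poly (on_line e) (xpoly f)).[x] = on_line e f.
Proof.
pose h : {rmorphism Rg -> Rg} := (horner_eval x \o (map_poly (on_line e) \o xpoly)).
rewrite -[LHS]/(h f); apply: rmorph_mpoly3_eq => [k|||];
  rewrite /h /= !xpolyE ?map_polyC ?map_polyX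
    /horner_eval ?hornerE /= ?on_lineE //.
Qed.

Lemma xpoly_at_point w e f :
  at_point w e ((map_poly (on_line e) (xpoly f)).[w%:MP * z]) = at_point w e f.
Proof.
pose h : {rmorphism Rg -> {poly K}} :=
  (at_point w e \o (horner_eval (w%:MP * z) \o
    (map_poly (on_line e) \o xpoly))).
rewrite -[LHS]/(h f); apply: rmorph_mpoly3_eq => [k|||];
  rewrite /h /= !xpolyE ?map_polyC ?map_polyX
    /horner_eval ?hornerE /= ?on_lineE ?rmorphM /= ?at_pointE //.
Qed.

Definition on_line_xpoly e : Rg -> {poly Rg} := map_poly (on_line e) \o xpoly.
HB.instance Definition _ e := GRing.RMorphism.copy (on_line_xpoly e)
  (map_poly (on_line e) \o xpoly).

Lemma on_line_xpoly_A e : e \in s -> on_line_xpoly e A = 0.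
Proof.
move=> es; rewrite /on_line_xpoly /=.
have -> : xpoly A = A%:P by rewrite rmorphB !rmorphXn /= !xpolyE polyCB !polyC_exp.
by rewrite map_polyC /= (on_line_A hs).
Qed.

Lemma on_line_xpoly_B e : on_line_xpoly e B = - \prod_(w <- s) ('X - (w%:MP * z)%:P).
Proof.
rewrite /on_line_xpoly /= xpoly_B rmorphB /= map_polyC map_polyXn /= rmorphXn /= on_lineE.
rewrite -opprB polyC_exp -(prod_roots_of_unity hs (polyC \o @mpolyC 3 K)); congr (- _).
by apply: eq_bigr => w _; rewrite polyCM.
Qed.

Lemma on_line_xpoly_dvd e w m f : e \in s -> w \in s -> J m f ->
  exists c, on_line_xpoly e f = ('X - (w%:MP * z)%:P) ^+ m * c.
Proof.
move=> es ws /pair_pow_mod_a[g [h ->]].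
exists ((- \prod_(v <- rem w s) ('X - (v%:MP * z)%:P)) ^+ m * on_line_xpoly e g).
rewrite rmorphD [X in _ + X]rmorphM [X in X + _]rmorphM rmorphXn /=.
rewrite on_line_xpoly_A // mul0r addr0 on_line_xpoly_B (big_rem w ws) /=.
by rewrite -mulrN exprMn -mulrA.
Qed.

(** On the line y = e z, as a polynomial in x, [f] has the [n] roots w z with
    multiplicity [m], and so it vanishes if its degree is less than [n m].  This
    holds for all the components of A. *)
Lemma pair_local_dvd_A m f : pair_local m f -> (size (xpoly f) <= n * m)%N ->
  exists g, f = A * g.
Proof.
move=> hf sf; apply: (dvd_A hs) => e es; rewrite -xpoly_on_line.
suff -> : map_poly (on_line e) (xpoly f) = 0 by rewrite horner0.
set p := map_poly _ _.
have sp : (size p <= n * m)%N.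
  by apply: leq_trans sf; exact: size_poly.
have [q eq] : exists q, p = \prod_(w <- s) ('X - (w%:MP * z)%:P) ^+ m * q.
  have sub : {subset s <= s} by [].
  elim: {1 2 4}s su sub => [|w l IH] /=; first by exists p; rewrite big_nil mul1r.
  move=> /andP[wl ul] sub; have [|q eq] := IH ul.
    by move=> w' w'l; apply: sub; rewrite inE w'l orbT.
  have ws : w \in s by apply: sub; rewrite mem_head.
  have [t [pt0 ht]] := hf w e ws es.
  have [c ec] := on_line_xpoly_dvd es ws ht.
  have ec' : ('X - (w%:MP * z)%:P) ^+ m * c =
      (on_line_xpoly e t * \prod_(w <- l) ('X - (w%:MP * z)%:P) ^+ m) * q.
    by rewrite -ec rmorphM -[X in _ * X = _]/p eq mulrA.
  have [|q' eq'] := dvd_XsubC_cancel ec'.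
    rewrite hornerM mulf_neq0 //.
      apply: contraNneq pt0 => h; rewrite -(xpoly_at_point w e t).
      by rewrite -[map_poly _ _]/(on_line_xpoly e t) h rmorph0.
    rewrite horner_prod prodf_seq_neq0; apply/allP => w' w'l /=.
    rewrite horner_exp expf_neq0 // hornerXsubC -mulrBl mulf_neq0 ?mpolyX_neq0 //.
    rewrite -rmorphB /= mpolyC_eq0 subr_eq0; apply: contraNneq wl => ->.
    exact: w'l.
  by exists q'; rewrite big_cons eq eq' mulrCA mulrA.
case: (eqVneq q 0) => [q0|q0]; first by rewrite eq q0 mulr0.
exfalso; have := sp.
rewrite prodrXl in eq.
have Pm : \prod_(w <- s) ('X - (w%:MP * z)%:P) \is monic by exact: monic_prod_XsubC.
rewrite eq size_monicM ?monic_exp //.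
have := size_exp (\prod_(w <- s) ('X - (w%:MP * z)%:P)) m.
rewrite size_prod_XsubC ss; have := q0; rewrite -size_poly_gt0.
move=> q1 h2; apply/negP; rewrite -ltnNge -h2.
case: (size q) q1 => // u _; rewrite addnS /=.
by apply: leq_trans (leq_addr _ _); rewrite prednK // size_poly_gt0 monic_neq0 ?monic_exp.
Qed.

(** Divide by B^m in x: the remainder still vanishes to order [m] at the points,
    so that A divides it by the bound on its degree in x, and induction applies
    to the quotient. *)
Lemma pair_local_pair_pow m f : pair_local m f -> J m f.
Proof.
elim: m f => [|m IH] f hf //.
have [g [h [e sh]]] := div_BX m.+1 f.
have hh : pair_local m.+1 h.
  move=> w v ws vs; have [t [t0 ht]] := hf w v ws vs; exists t; split=> //.
  have -> : h = f - B ^+ m.+1 * g by rewrite e addrAC subrr add0r.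
  rewrite mulrBr; apply: (idealB (pair_pow_ideal _ _ _)) => //.
  by rewrite mulrCA; exact: pair_pow_bX.
have [h' eh] := pair_local_dvd_A hh sh.
exists g, h'; split; first by rewrite e eh.
apply: IH => w v ws vs; have [t [t0 ht]] := hh w v ws vs; exists t; split=> //.
by apply: (@pair_pow_colonA _ _ _ hs m.+1); rewrite mulrCA -eh.
Qed.

(** The [n^2] points have nonzero coordinates. *)
Lemma pair_pow_xcancel m f : J m (x * f) -> J m f.
Proof.
move=> h; apply: pair_local_pair_pow => w e ws es; exists x; split=> //.
rewrite at_pointE mulf_neq0 ?polyX_eq0 // polyC_eq0.
apply: contraTneq (allP s1 _ ws) => ->.
by rewrite expr0n gtn_eqF // eq_sym oner_eq0.
Qed.

End Local.

(** * Forms vanishing at the four points *)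

Section Cox.
Variables (K : fieldType) (n : nat) (s : seq K).
Hypothesis hs : full_roots n s.
Let n3 : (3 <= n)%N. Proof. by case: hs. Qed.
Let n_gt0 : (0 < n)%N. Proof. exact: leq_trans n3. Qed.

Local Notation Rg := {mpoly K[3]}.
Local Notation x := ('X_i0 : Rg).
Local Notation y := ('X_i1 : Rg).
Local Notation z := ('X_i2 : Rg).
Local Notation A := (y ^+ n - z ^+ n).
Local Notation B := (z ^+ n - x ^+ n).
Local Notation J := (pair_pow A B).
Local Notation M := (line_prod n x y z).

(** The linear span of the products of lines with given orders and degree, given
    by its induction principle. *)
Definition line_span m0 m1 m2 m3 D : set Rg :=
  [set f | forall P : Rg -> Prop, P 0 -> (forall g h, P g -> P h -> P (g + h)) ->
     (forall l i j k a b c, line_ord n m0 m1 m2 m3 i j k a b c ->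
        line_deg n i j k a b c = D -> P (l *: M i j k a b c)) -> P f].

Lemma line_span0 m0 m1 m2 m3 D : line_span m0 m1 m2 m3 D 0. Proof. by []. Qed.
Lemma line_spanD m0 m1 m2 m3 D f g : line_span m0 m1 m2 m3 D f ->
  line_span m0 m1 m2 m3 D g ->
  line_span m0 m1 m2 m3 D (f + g).
Proof. by move=> hf hg P P0 PD PM; apply: (PD); [exact: hf|exact: hg]. Qed.
Lemma line_spanM m0 m1 m2 m3 D l i j k a b c : line_ord n m0 m1 m2 m3 i j k a b c ->
  line_deg n i j k a b c = D -> line_span m0 m1 m2 m3 D (l *: M i j k a b c).
Proof. by move=> o d P P0 PD PM; apply: PM. Qed.

Lemma supp_var i m : ('X_i : Rg)@_m != 0 -> m = U_(i)%MM.
Proof. by rewrite mcoeffX; case: (eqVneq U_(i)%MM m) => //= _; rewrite eqxx. Qed.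

Lemma order_ge_var u v w i : order_ge u v w (weight u v w U_(i)) ('X_i : Rg).
Proof. by move=> m /supp_var ->. Qed.

Lemma order_ge_subX u v w i j d : (d <= weight u v w U_(i))%N -> (d <= weight u v w U_(j))%N ->
  order_ge u v w (n * d) ('X_i ^+ n - 'X_j ^+ n : Rg).
Proof.
have h t : (d <= weight u v w U_(t))%N -> order_ge u v w (n * d) ('X_t ^+ n : Rg).
  by move=> ht; apply: order_geX; apply: order_ge_le ht _; exact: order_ge_var.
by move=> hi hj; apply: (idealB (order_ge_ideal K u v w (n * d))); exact: h.
Qed.

Lemma weightU u v w : (weight u v w U_(i0) = u) * (weight u v w U_(i1) = v) *
  (weight u v w U_(i2) = w).
Proof.
have e01 : (i0 == i1) = false by rewrite -val_eqE /= !inordK.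
have e02 : (i0 == i2) = false by rewrite -val_eqE /= !inordK.
have e12 : (i1 == i2) = false by rewrite -val_eqE /= !inordK.
rewrite /weight !mnmE !eqxx e01 e02 e12 ![_ == i0]eq_sym e01 e02 [i2 == _]eq_sym e12.
by do !split; lia.
Qed.

Lemma order_ge_line_prod u v w i j k a b c :
  order_ge u v w (u * i + v * j + w * k +
    (a * (n * minn v w) + b * (n * minn w u) + c * (n * minn u v))) (M i j k a b c).
Proof.
have hX t e : order_ge u v w (weight u v w U_(t) * e) ('X_t ^+ e : Rg).
  by rewrite mulnC; apply: order_geX; exact: order_ge_var.
have := hX i0 i; have := hX i1 j; have := hX i2 k; rewrite !weightU => hk hj hi.
by apply: order_geM; apply: order_geM => //; [apply: order_geM|apply: order_geM|] => //;
  apply: order_geX; apply: order_ge_subX; rewrite !weightU ?geq_minl ?geq_minr.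
Qed.

Lemma hom_deg_var i : hom_deg 1 ('X_i : Rg).
Proof.
move=> m /supp_var ->; rewrite /weight !mul1n.
have : mdeg (U_(i) : 'X_{1..3}) = 1%N by rewrite mdeg1.
rewrite mdegE !big_ord_recl big_ord0 addn0 addnA.
have -> : lift ord0 (lift ord0 ord0) = i2 by apply/val_inj; rewrite /= inordK.
have -> : lift ord0 ord0 = i1 by apply/val_inj; rewrite /= inordK.
by have -> : ord0 = i0 by apply/val_inj; rewrite /= inordK.
Qed.

Lemma hom_degN D (p : Rg) : hom_deg D p -> hom_deg D (- p).
Proof. by move=> h; rewrite -scaleN1r; exact: hom_degZ. Qed.

Lemma hom_deg_subXn i j : hom_deg n ('X_i ^+ n - 'X_j ^+ n : Rg).
Proof.
have h t : hom_deg n ('X_t ^+ n : Rg).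
  by rewrite -[X in hom_deg X]muln1; apply: hom_degX; exact: hom_deg_var.
by apply: hom_degD => //; exact: hom_degN.
Qed.

Lemma hom_deg_line_prod i j k a b c : hom_deg (line_deg n i j k a b c) (M i j k a b c).
Proof.
have hv t e : hom_deg e ('X_t ^+ e : Rg).
  by rewrite -[X in hom_deg X]muln1; apply: hom_degX; exact: hom_deg_var.
have hd t u e : hom_deg (e * n) (('X_t ^+ n - 'X_u ^+ n) ^+ e : Rg).
  by apply: hom_degX; exact: hom_deg_subXn.
have -> : line_deg n i j k a b c = (i + j + k + (a * n + b * n + c * n))%N.
  by rewrite /line_deg; lia.
by do ?apply: hom_degM.
Qed.

Definition at_x0 : Rg -> Rg := eval3 (@mpolyC 3 K) 0 y z.
HB.instance Definition _ := GRing.RMorphism.copy at_x0 (eval3 (@mpolyC 3 K) 0 y z).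
Lemma at_x0x : at_x0 x = 0. Proof. exact: eval3x. Qed.
Lemma at_x0y : at_x0 y = y. Proof. exact: eval3y. Qed.
Lemma at_x0z : at_x0 z = z. Proof. exact: eval3z. Qed.
Lemma at_x0C l : at_x0 l%:MP = l%:MP. Proof. exact: eval3C. Qed.

Lemma at_x0_coef p m : (at_x0 p)@_m = if m i0 == 0%N then p@_m else 0.
Proof.
elim/mpolyind: p => [|c m' p _ _ IH].
  by rewrite rmorph0 !mcoeff0 if_same.
rewrite rmorphD mcoeffD IH [in RHS]mcoeffD mcoeffZ mcoeffX [in LHS]mpolyX3.
rewrite rmorph_mono /= at_x0x at_x0y at_x0z at_x0C expr0n mcoeffCM.
case: (eqVneq (m' i0) 0%N) => [e0|n0].
  have EX : 'X_[m'] = y ^+ m' i1 * z ^+ m' i2 by rewrite mpolyX3 e0 expr0 mul1r.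
  rewrite mul1r -EX mcoeffX; case: (eqVneq (m i0) 0%N) => // nm.
  have /negPf -> : m' != m by apply: contraNneq nm => <-; rewrite e0.
  by rewrite mulr0 addr0.
rewrite !mul0r mcoeff0 mulr0 add0r; case: (eqVneq (m i0) 0%N) => // nm.
have /negPf -> : m' != m by apply: contraNneq n0 => ->; rewrite nm.
by rewrite mulr0 add0r.
Qed.

Lemma at_x0_mod p : exists q, p = at_x0 p + x * q.
Proof.
pose I : set Rg := [set p | exists q, p = x * q].
have iI : is_ideal I.
  split; first by exists 0; rewrite mulr0.
    by move=> _ _ [q ->] [r ->]; exists (q + r); rewrite mulrDr.
  by move=> u _ [q ->]; exists (u * q); rewrite mulrCA.
have [||||q e] := @subst_congr K I at_x0 iI _ _ _ _ p => /=.
- exact: at_x0C.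
- by exists 1; rewrite at_x0x subr0 mulr1.
- by exists 0; rewrite at_x0y subrr mulr0.
- by exists 0; rewrite at_x0z subrr mulr0.
by exists q; rewrite -e addrC subrK.
Qed.

(** Every monomial lies in the [l]-th power of (y^n, z^n), the restriction of the
    ideal (A, B) to the line x = 0. *)
Definition YZorder l (p : Rg) := forall m, p@_m != 0 -> (l <= m i1 %/ n + m i2 %/ n)%N.

Lemma YZorderD l p q : YZorder l p -> YZorder l q -> YZorder l (p + q).
Proof.
move=> hp hq m; rewrite mcoeffD; case: (eqVneq (p@_m) 0) => [->|/hp //].
by rewrite add0r; exact: hq.
Qed.

Lemma YZorderM l d (m' : 'X_{1..3}) p : YZorder l p -> (d <= m' i1 %/ n + m' i2 %/ n)%N ->
  YZorder (d + l) ('X_[m'] * p).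
Proof.
move=> hp hd m; rewrite -mcoeff_msupp mulrC (perm_mem (msuppMX _ _)).
case/mapP => k; rewrite mcoeff_msupp => /hp hk ->.
rewrite !mnmDE; apply: leq_trans (leq_add hd hk) _.
by rewrite addnACA; apply: leq_add; rewrite leq_divRL // mulnDl leq_add ?leq_trunc_div.
Qed.

Lemma YZorder_ideal l : is_ideal (YZorder l).
Proof.
split; [by move=> m; rewrite mcoeff0 eqxx | by move=> *; exact: YZorderD |].
move=> u p hp; elim/mpolyind: u => [|c m u _ _ IH].
  by rewrite mul0r => m; rewrite mcoeff0 eqxx.
rewrite mulrDl; apply: YZorderD => //; rewrite -scalerAl => m'.
rewrite mcoeffZ mulf_eq0 negb_or => /andP[_].
by apply: (YZorderM (d := 0)).
Qed.

Lemma YZorder_XnM l e i p : i = i1 \/ i = i2 -> YZorder l p ->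
  YZorder (e + l) (('X_i ^+ n) ^+ e * p).
Proof.
move=> hi hp; elim: e => [|e IH]; first by rewrite mul1r.
rewrite exprS -mulrA addSn -add1n {1}mpolyXn; apply: YZorderM; first exact: IH.
rewrite !mulmnE; case: hi => ->; rewrite !mnmE eqxx mul1n divnn n_gt0.
  by rewrite leq_addr.
by rewrite leq_addl.
Qed.

Lemma pair_pow_at_x0 l p : J l p -> YZorder l (at_x0 p).
Proof.
elim: l p => [|l IH] p; first by move=> _ m.
case=> g [h [-> /IH hh]].
rewrite rmorphD [X in YZorder _ (_ + X)]rmorphM [X in YZorder _ (X + _)]rmorphM rmorphXn /=.
have -> : at_x0 B = z ^+ n by rewrite rmorphB !rmorphXn /= at_x0x at_x0z expr0n gtn_eqF ?subr0.
have -> : at_x0 A = A by rewrite rmorphB !rmorphXn /= at_x0y at_x0z.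
apply: YZorderD.
  by rewrite -[X in YZorder X]addn0; apply: YZorder_XnM => //; right.
rewrite mulrBl; apply: (idealB (YZorder_ideal _)).
  by rewrite -[y ^+ n]expr1 -add1n; apply: YZorder_XnM => //; left.
by rewrite -[z ^+ n]expr1 -add1n; apply: YZorder_XnM => //; right.
Qed.

(** The points are taken in the same order as for [line_ord]; the weight
    (0, 1, 1) measures the order at (1 : 0 : 0), and similarly for the others. *)
Record fat_form m0 m1 m2 m3 D (f : Rg) : Prop := FatForm {
  fat_formJ : J m0 f;
  fat_form1 : order_ge 0 1 1 m1 f;
  fat_form2 : order_ge 1 0 1 m2 f;
  fat_form3 : order_ge 1 1 0 m3 f;
  fat_formD : hom_deg D f }.

Lemma fat_form_add m0 m1 m2 m3 D f g : fat_form m0 m1 m2 m3 D f -> fat_form m0 m1 m2 m3 D g ->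
  fat_form m0 m1 m2 m3 D (f + g).
Proof.
case=> a1 a2 a3 a4 a5 [b1 b2 b3 b4 b5]; split.
- exact: (idealD (pair_pow_ideal _ _ _)).
- exact: (idealD (order_ge_ideal _ _ _ _ _)).
- exact: (idealD (order_ge_ideal _ _ _ _ _)).
- exact: (idealD (order_ge_ideal _ _ _ _ _)).
- exact: hom_degD.
Qed.

Lemma fat_form_scale m0 m1 m2 m3 D l f : fat_form m0 m1 m2 m3 D f ->
  fat_form m0 m1 m2 m3 D (l *: f).
Proof.
rewrite -mul_mpolyC; case=> a1 a2 a3 a4 a5; split.
- exact: (idealMl _ (pair_pow_ideal _ _ _)).
- exact: (idealMl _ (order_ge_ideal _ _ _ _ _)).
- exact: (idealMl _ (order_ge_ideal _ _ _ _ _)).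
- exact: (idealMl _ (order_ge_ideal _ _ _ _ _)).
- by rewrite mul_mpolyC; exact: hom_degZ.
Qed.

Lemma line_span_fat_form m0 m1 m2 m3 D : line_span m0 m1 m2 m3 D `<=` fat_form m0 m1 m2 m3 D.
Proof.
move=> f; apply => [|g h|l i j k a b c].
- split; try exact: hom_deg0; try exact: (ideal0 (order_ge_ideal _ _ _ _ _)).
  exact: (ideal0 (pair_pow_ideal _ _ _)).
- exact: fat_form_add.
case/and4P=> h0 h1 h2 h3 <-; apply: fat_form_scale; split.
- by apply: pair_pow_le h0 _ _; exact: pair_pow_line_prod.
- by refine (order_ge_le _ (@order_ge_line_prod 0 1 1 i j k a b c)); rewrite /minn /=; nia.
- by refine (order_ge_le _ (@order_ge_line_prod 1 0 1 i j k a b c)); rewrite /minn /=; nia.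
- by refine (order_ge_le _ (@order_ge_line_prod 1 1 0 i j k a b c)); rewrite /minn /=; nia.
- exact: hom_deg_line_prod.
Qed.

Lemma line_span_mulx m0 m1 m2 m3 D g : line_span m0 m1 m2.-1 m3.-1 D g ->
  line_span m0 m1 m2 m3 D.+1 (x * g).
Proof.
move=> hg; apply: (hg (fun g => line_span m0 m1 m2 m3 D.+1 (x * g)))
  => [|p q|l i j k a b c o d].
- by rewrite mulr0; exact: line_span0.
- by rewrite mulrDr; exact: line_spanD.
rewrite -scalerAr.
rewrite -line_prod_x.
by apply: line_spanM; move: o d; rewrite /line_ord /line_deg; lia.
Qed.

Lemma line_span_mulA m0 m1 m2 m3 D g : line_span m0.-1 (m1 - n) m2 m3 D g ->
  line_span m0 m1 m2 m3 (D + n) (A * g).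
Proof.
move=> hg; apply: (hg (fun g => line_span m0 m1 m2 m3 (D + n) (A * g)))
  => [|p q|l i j k a b c o d].
- by rewrite mulr0; exact: line_span0.
- by rewrite mulrDr; exact: line_spanD.
rewrite -scalerAr.
rewrite -line_prod_a.
by apply: line_spanM; move: o d; rewrite /line_ord /line_deg; lia.
Qed.

Lemma at_x0_line_prod j k b c :
  at_x0 (M 0 j k 0 b c) = (-1) ^+ c * (y ^+ (j + n * c) * z ^+ (k + n * b)).
Proof.
by rewrite rmorph_line_prod /= at_x0x at_x0y at_x0z line_prod0.
Qed.

(** On the line x = 0 the lines B and C restrict to z^n and - y^n.  A monomial
    y^j z^k of the restriction is therefore that of a product of y, z, B, C; exactly
    [m0] factors B, C are used, since the lines y and z have then to
    provide the order [m1], for which the bound on the degree leaves just enough. *)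
Lemma lift_at_x0 m0 m1 m2 m3 D f : fat_form m0 m1 m2 m3 D f -> (n * m0 + m1 <= D)%N ->
  exists2 g, line_span m0 m1 m2 m3 D g & at_x0 g = at_x0 f.
Proof.
case=> fJ f1 f2 f3 fD hD.
apply: (mpoly3_span (P := fun p => exists2 g, line_span m0 m1 m2 m3 D g & at_x0 g = p)).
- by exists 0; [exact: line_span0|exact: rmorph0].
- move=> _ _ [g hg <-] [h hh <-]; exists (g + h); first exact: line_spanD.
  exact: rmorphD.
move=> m nz; have := pair_pow_at_x0 fJ nz; move: nz; rewrite at_x0_coef.
case: (eqVneq (m i0) 0%N) => [e0 nz|_]; last by rewrite eqxx.
have := f1 m nz; have := f2 m nz; have := f3 m nz; have := fD m nz.
rewrite /weight e0 expr0 mul1r; move: (m i1) (m i2) => j k dD h3 h2 h1 h0.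
pose c := minn m0 (j %/ n); pose b := (m0 - c)%N.
have cj : (n * c <= j)%N.
  by rewrite mulnC -leq_divRL // geq_minr.
have bk : (n * b <= k)%N.
  rewrite mulnC -leq_divRL // /b /c; move: h0; clear.
  by move: (j %/ n)%N (k %/ n)%N => u v; lia.
have bc : (b + c = m0)%N by rewrite /b subnK // geq_minl.
clearbody b; clearbody c.
exists ((f@_m * (-1) ^+ c) *: M 0 (j - n * c) (k - n * b) 0 b c).
  by apply: line_spanM; rewrite /line_ord /line_deg; nia.
rewrite -[X in at_x0 X]mul_mpolyC -[RHS]mul_mpolyC rmorphM /= at_x0C at_x0_line_prod !subnK //.
rewrite mpolyCM -mulrA; congr (_ * _).
by rewrite mulrA rmorphXn rmorphN1 -expr2 sqrr_sign mul1r.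
Qed.

Lemma grade_subXn u v w i j : grade u v w ('X_i ^+ n - 'X_j ^+ n : Rg) =
  ('X_i ^+ n)%:P * 'X^(weight u v w U_(i) * n) - ('X_j ^+ n)%:P * 'X^(weight u v w U_(j) * n).
Proof.
by rewrite rmorphB !rmorphXn /= !gradeX !exprMn -!exprM.
Qed.

(** Induction on the degree.  The line A of the plane with coordinates X, Y, Z
    joins the points X = Y = Z and (1 : 0 : 0).  If n m0 + m1 > D, then by Bezout
    A divides the form.  Otherwise a combination of products of lines agrees
    with the form on x = 0, and x divides the difference. *)
Lemma fat_form_line_span D m0 m1 m2 m3 f :
  fat_form m0 m1 m2 m3 D f -> line_span m0 m1 m2 m3 D f.
Proof.
elim/ltn_ind: D m0 m1 m2 m3 f => D IH m0 m1 m2 m3 f hf.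
case: (eqVneq f 0) => [->|f0]; first exact: line_span0.
case: (leqP (n * m0 + m1) D) => hD.
  have [g hg e] := lift_at_x0 hf hD.
  have [h eh] := at_x0_mod (f - g).
  have {}eh : f - g = x * h by rewrite {1}eh rmorphB /= e subrr add0r.
  have ef : f = g + x * h by rewrite -eh addrC subrK.
  rewrite ef; apply: line_spanD => //.
  case: (eqVneq h 0) => [->|h0]; first by rewrite mulr0; exact: line_span0.
  have : fat_form m0 m1 m2 m3 D (x * h).
    rewrite -eh -scaleN1r; apply: fat_form_add => //; apply: fat_form_scale.
    exact: line_span_fat_form.
  case=> xJ x1 x2 x3 xD.
  have [D0 hD1] := hom_deg_cancel (@hom_deg_var i0) (mpolyX_neq0 _ _) xD h0.
  rewrite -(subnK D0) addn1; apply: line_span_mulx; apply: IH; first by lia.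
  split=> //.
  - exact: (pair_pow_xcancel hs xJ).
  - rewrite -[m1]subn0; apply: (order_ge_cancel (q' := x%:P) x1).
      by rewrite gradex mulrC.
    by rewrite coefC mpolyX_neq0.
  - rewrite -subn1; apply: (order_ge_cancel (q' := x%:P) x2).
      by rewrite gradex mulrC.
    by rewrite coefC mpolyX_neq0.
  - rewrite -subn1; apply: (order_ge_cancel (q' := x%:P) x3).
      by rewrite gradex mulrC.
    by rewrite coefC mpolyX_neq0.
case: hf => fJ f1 f2 f3 fD.
have [|g eg] := pair_local_dvd_A hs (pair_pow_pair_local fJ).
  apply: size_xpoly => m nz; have := f1 m nz; have := fD m nz; rewrite /weight; lia.
have g0 : g != 0 by apply: contraNneq f0 => g0; rewrite eg g0 mulr0.
rewrite eg in fJ f1 f2 f3 fD *.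
have [D0 hD1] := hom_deg_cancel (@hom_deg_subXn i1 i2) (A_neq0 hs) fD g0.
rewrite -(subnK D0); apply: line_span_mulA; apply: IH; first by lia.
have Xn0 i : ('X_i ^+ n : Rg) != 0 by rewrite expf_neq0 ?mpolyX_neq0.
split=> //.
- exact: (pair_pow_colonA hs).
- apply: (order_ge_cancel (q' := A%:P) f1).
    by rewrite grade_subXn !weightU mul1n -mulrBl -polyCB mulrC.
  by rewrite coefC (A_neq0 hs).
- rewrite -[m2]subn0; apply: (order_ge_cancel (q' := grade 1 0 1 A) f2).
    by rewrite mul1r.
  by rewrite grade_subXn !weightU mul1n mul0n mulr1 coefB coefC coefMXn n_gt0 subr0 Xn0.
- rewrite -[m3]subn0; apply: (order_ge_cancel (q' := grade 1 1 0 A) f3).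
    by rewrite mul1r.
  rewrite grade_subXn !weightU mul1n mul0n mulr1 coefB coefC coefMXn n_gt0.
  by rewrite sub0r oppr_eq0 Xn0.
Qed.

End Cox.

(** * Symbolic powers of the Fermat ideal *)

Lemma symbolic_power_local (A : idomainType) (I P : set A) m f :
  symbolic_power I m f -> Ass I P ->
  exists s, ~ P s /\ ideal_pow I m (s * f).
Proof.
move=> hf hP; have [a [s [Ia Ps e]]] := hf P hP.
exists s; split=> //.
have s0 : s != 0.
  by apply/eqP => s0; apply: Ps; rewrite s0; case: hP => -[[]].
suff -> : s * f = a by [].
apply/eqP; rewrite -tofrac_eq tofracM e mulrC divfK //.
by rewrite tofrac_eq0.
Qed.

Section Generators.
Variables (S : comNzRingType) (n : nat) (x y z : S).

Lemma line_prod_genx : line_prod n x y z 1 0 0 1 0 0 = x * (y ^+ n - z ^+ n).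
Proof. by rewrite /line_prod !expr1 !expr0 !mulr1. Qed.
Lemma line_prod_geny : line_prod n x y z 0 1 0 0 1 0 = y * (z ^+ n - x ^+ n).
Proof. by rewrite /line_prod !expr1 !expr0 !mulr1 !mul1r. Qed.
Lemma line_prod_genz : line_prod n x y z 0 0 1 0 0 1 = z * (x ^+ n - y ^+ n).
Proof. by rewrite /line_prod !expr1 !expr0 !mulr1 !mul1r. Qed.

Lemma point_shuffle_x (w px py : S) : w * px = x ^+ n - z ^+ n ->
  w * (x * y * z * (px * py)) = - (x * z * py) * (y * (z ^+ n - x ^+ n)).
Proof.
move=> e; have -> : w * (x * y * z * (px * py)) = (w * px) * (x * y * z * py) by ring.
by rewrite e; ring.
Qed.

Lemma point_shuffle_y (w px py : S) : w * py = y ^+ n - z ^+ n ->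
  w * (x * y * z * (px * py)) = (y * z * px) * (x * (y ^+ n - z ^+ n)).
Proof.
move=> e; have -> : w * (x * y * z * (px * py)) = (w * py) * (x * y * z * px) by ring.
by rewrite e; ring.
Qed.
End Generators.

Section Symbolic.
Variables (K : fieldType) (n : nat) (s : seq K).
Hypothesis hs : full_roots n s.
Let n3 : (3 <= n)%N. Proof. by case: hs. Qed.
Let su : uniq s. Proof. by case: hs. Qed.
Let ss : size s = n. Proof. by case: hs. Qed.
Let s1 : all (fun w => w ^+ n == 1) s. Proof. by case: hs. Qed.
Let n_gt0 : (0 < n)%N. Proof. exact: leq_trans n3. Qed.

Local Notation Rg := {mpoly K[3]}.
Local Notation x := ('X_i0 : Rg).
Local Notation y := ('X_i1 : Rg).
Local Notation z := ('X_i2 : Rg).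
Local Notation A := (y ^+ n - z ^+ n).
Local Notation B := (z ^+ n - x ^+ n).
Local Notation C := (x ^+ n - y ^+ n).
Local Notation J := (pair_pow A B).
Local Notation M := (line_prod n x y z).
Local Notation I := (fermat n x y z).

Let iI : is_ideal I. Proof. exact: ideal_gen_ideal. Qed.

Lemma fermat_order_ge u v w d : (d <= u + n * minn v w)%N -> (d <= v + n * minn w u)%N ->
  (d <= w + n * minn u v)%N -> I `<=` order_ge u v w d.
Proof.
move=> h1 h2 h3; apply: fermat_sub; first exact: order_ge_ideal.
- rewrite -line_prod_genx.
  by refine (order_ge_le _ (@order_ge_line_prod K n s hs u v w 1 0 0 1 0 0)); lia.
- rewrite -line_prod_geny.
  by refine (order_ge_le _ (@order_ge_line_prod K n s hs u v w 0 1 0 0 1 0)); lia.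
- rewrite -line_prod_genz.
  by refine (order_ge_le _ (@order_ge_line_prod K n s hs u v w 0 0 1 0 0 1)); lia.
Qed.

Section Kernel.
Variables (a b c : {poly K}) (v u : Rg).
Local Notation phi := (eval3 (@polyC K) a b c).
Definition back (p : {poly K}) : Rg := (map_poly (@mpolyC 3 K) p).[v].

(** The kernel of an evaluation is the annihilator of [u] modulo [I] as soon as
    [u] lies outside it and carries its generators, the differences between the
    variables and their values, into [I]. *)
Lemma kernel_Ass : phi u != 0 -> a * (b ^+ n - c ^+ n) = 0 ->
  b * (c ^+ n - a ^+ n) = 0 -> c * (a ^+ n - b ^+ n) = 0 ->
  I ((x - back a) * u) -> I ((y - back b) * u) -> I ((z - back c) * u) ->
  Ass I [set g | phi g = 0].
Proof.
move=> u0 ha hb hc hx hy hz.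
have ik : is_ideal [set g : Rg | phi g = 0].
  split=> /=; first exact: rmorph0.
    by move=> f g hf hg; rewrite rmorphD /= hf hg addr0.
  by move=> f g hg; rewrite rmorphM /= hg mulr0.
have Iphi : I `<=` [set g : Rg | phi g = 0].
  apply: fermat_sub => //=; rewrite rmorphM rmorphB !rmorphXn /= !eval3E.
  - exact: ha.
  - exact: hb.
  - exact: hc.
split; first split=> //=.
- by rewrite rmorph1; apply/eqP; rewrite oner_eq0.
- move=> f g; rewrite rmorphM /= => /eqP; rewrite mulf_eq0.
  by case/orP => /eqP; [left|right].
exists u; apply/seteqP; split=> g /=.
  move=> pg.
  pose sg : {rmorphism Rg -> Rg} := (horner_eval v \o (map_poly (@mpolyC 3 K) \o phi)).
  have sx : sg x = back a by rewrite /sg /= eval3x.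
  have sy : sg y = back b by rewrite /sg /= eval3y.
  have sz : sg z = back c by rewrite /sg /= eval3z.
  have sC k : sg k%:MP = k%:MP by rewrite /sg /= eval3C map_polyC /horner_eval hornerC.
  have hx' : I (u * (x - sg x)) by rewrite sx mulrC.
  have hy' : I (u * (y - sg y)) by rewrite sy mulrC.
  have hz' : I (u * (z - sg z)) by rewrite sz mulrC.
  have := @subst_congr K [set p | I (u * p)] sg (colon_ideal _ iI) sC hx' hy' hz' g.
  by rewrite /sg /= pg rmorph0 /horner_eval horner0 subr0 mulrC.
move/Iphi; rewrite /= rmorphM /= => /eqP; rewrite mulf_eq0 (negPf u0) orbF.
by move/eqP.
Qed.
End Kernel.

Let rn0 w : w \in s -> w != 0.
Proof.
move=> ws; apply: contraTneq (allP s1 _ ws) => ->.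
by rewrite expr0n gtn_eqF // eq_sym oner_eq0.
Qed.

(** The witness is the product of all the lines x = v z, y = v z that avoid the
    point, together with x y z. *)
Lemma at_point_Ass w e : w \in s -> e \in s -> Ass I [set g | at_point w e g = 0].
Proof.
move=> ws es.
have back_lin (l : K) : back z (l%:P * 'X) = l%:MP * z.
  by rewrite /back rmorphM /= map_polyC map_polyX hornerM hornerC hornerX.
have prodx : \prod_(v <- s) (x - v%:MP * z) = x ^+ n - z ^+ n.
  exact: (prod_roots_of_unity hs (@mpolyC 3 K)).
have prody : \prod_(v <- s) (y - v%:MP * z) = y ^+ n - z ^+ n.
  exact: (prod_roots_of_unity hs (@mpolyC 3 K)).
rewrite (big_rem w ws) /= in prodx; rewrite (big_rem e es) /= in prody.
set px := \prod_(_ <- _) _ in prodx; set py := \prod_(_ <- _) _ in prody.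
have wn : w ^+ n = 1 by apply/eqP/(allP s1).
have en : e ^+ n = 1 by apply/eqP/(allP s1).
have Xn l : l ^+ n = 1 -> (l%:P * 'X : {poly K}) ^+ n = 'X^n.
  by move=> ln; rewrite exprMn -polyC_exp ln mul1r.
apply: (kernel_Ass (v := z) (u := (x * y * z) * (px * py))).
- rewrite !rmorphM /= !eval3E !mulf_neq0 ?polyX_eq0 ?polyC_eq0 ?rn0 //.
    rewrite /px rmorph_prod /= prodf_seq_neq0; apply/allP => v vs /=.
    rewrite rmorphB rmorphM /= !eval3E -mulrBl -polyCB mulf_neq0 ?polyX_eq0 //.
    rewrite polyC_eq0 subr_eq0; apply: contraTneq vs => ->.
    by rewrite mem_rem_uniq // inE eqxx.
  rewrite /py rmorph_prod /= prodf_seq_neq0; apply/allP => v vs /=.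
  rewrite rmorphB rmorphM /= !eval3E -mulrBl -polyCB mulf_neq0 ?polyX_eq0 //.
  rewrite polyC_eq0 subr_eq0; apply: contraTneq vs => ->.
  by rewrite mem_rem_uniq // inE eqxx.
- by rewrite Xn // subrr mulr0.
- by rewrite Xn // subrr mulr0.
- by rewrite !Xn // subrr mulr0.
- rewrite back_lin.
  rewrite (point_shuffle_x y py prodx).
  by apply: (idealMl _ iI); exact: fermat_y.
- rewrite back_lin.
  rewrite (point_shuffle_y x px prody).
  by apply: (idealMl _ iI); exact: fermat_x.
rewrite /back map_polyX hornerX subrr mul0r; exact: ideal0.
Qed.

Lemma back0 v : back v 0 = 0. Proof. by rewrite /back rmorph0 horner0. Qed.
Lemma backX v : back v 'X = v. Proof. by rewrite /back map_polyX hornerX. Qed.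

Lemma z_point_Ass : Ass I [set g | eval3 (@polyC K) 0 0 'X g = 0].
Proof.
have X0 : ('X^n : {poly K}) != 0 by rewrite -size_poly_eq0 size_polyXn.
have n0 : (n == 0)%N = false by rewrite gtn_eqF.
apply: (kernel_Ass (v := z) (u := A * B));
  rewrite ?back0 ?backX ?subr0 ?subrr ?mul0r ?expr0n ?n0 ?subrr ?mulr0 //.
- rewrite rmorphM !rmorphB !rmorphXn /= !eval3E expr0n n0 sub0r subr0.
  by rewrite mulf_neq0 ?oppr_eq0.
- by rewrite mulrA mulrC; apply: (idealMl _ iI); exact: fermat_x.
- by rewrite mulrCA; apply: (idealMl _ iI); exact: fermat_y.
- exact: ideal0.
Qed.

Lemma y_point_Ass : Ass I [set g | eval3 (@polyC K) 0 'X 0 g = 0].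
Proof.
have X0 : ('X^n : {poly K}) != 0 by rewrite -size_poly_eq0 size_polyXn.
have n0 : (n == 0)%N = false by rewrite gtn_eqF.
apply: (kernel_Ass (v := y) (u := A * C));
  rewrite ?back0 ?backX ?subr0 ?subrr ?mul0r ?expr0n ?n0 ?subrr ?mulr0 //.
- rewrite rmorphM !rmorphB !rmorphXn /= !eval3E expr0n n0 sub0r subr0.
  by rewrite mulf_neq0 ?oppr_eq0.
- by rewrite mulrA mulrC; apply: (idealMl _ iI); exact: fermat_x.
- exact: ideal0.
- by rewrite mulrCA; apply: (idealMl _ iI); exact: fermat_z.
Qed.

Lemma x_point_Ass : Ass I [set g | eval3 (@polyC K) 'X 0 0 g = 0].
Proof.
have X0 : ('X^n : {poly K}) != 0 by rewrite -size_poly_eq0 size_polyXn.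
have n0 : (n == 0)%N = false by rewrite gtn_eqF.
apply: (kernel_Ass (v := x) (u := B * C));
  rewrite ?back0 ?backX ?subr0 ?subrr ?mul0r ?expr0n ?n0 ?subrr ?mulr0 //.
- rewrite rmorphM !rmorphB !rmorphXn /= !eval3E expr0n n0 sub0r subr0.
  by rewrite mulf_neq0 ?oppr_eq0.
- exact: ideal0.
- by rewrite mulrA mulrC; apply: (idealMl _ iI); exact: fermat_y.
- by rewrite mulrCA; apply: (idealMl _ iI); exact: fermat_z.
Qed.

(** At a point where the variables of positive weight vanish, an element outside
    the prime of the point has order zero and can be cancelled. *)
Lemma order_ge_local u v w (a b c : {poly K}) l t f :
  a * 0 ^+ u = a -> b * 0 ^+ v = b -> c * 0 ^+ w = c ->
  eval3 (@polyC K) a b c t != 0 -> order_ge u v w l (t * f) -> order_ge u v w l f.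
Proof.
move=> ha hb hc t0 o; rewrite -[l]subn0; apply: (order_ge_cancel (q' := grade u v w t) o).
  by rewrite mul1r.
apply: contraNneq t0 => g0; rewrite -horner_coef0 in g0.
pose h : {rmorphism Rg -> {poly K}} :=
  (eval3 (@polyC K) a b c \o (horner_eval 0 \o grade u v w)).
have <- : h t = eval3 (@polyC K) a b c t; last by rewrite /h /= /horner_eval g0 rmorph0.
apply: rmorph_mpoly3_eq => [k|||]; rewrite /h /= ?gradeE /horner_eval
  ?hornerM ?hornerC ?hornerXn ?rmorphM ?rmorphXn ?rmorph0 /= !eval3E //.
Qed.

Lemma symbolic_pair_pow m f : symbolic_power I m f -> J m f.
Proof.
move=> hf; apply: (pair_local_pair_pow hs) => w e ws es.
have [t [/= t0 ht]] := symbolic_power_local hf (at_point_Ass ws es).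
by exists t; split; [apply/eqP|exact: fermat_pow_pair_pow].
Qed.

Lemma symbolic_order_z m f : symbolic_power I m f -> order_ge 1 1 0 m f.
Proof.
move=> /symbolic_power_local/(_ z_point_Ass)[t [/= /eqP t0 ht]].
apply: (order_ge_local (t := t) (u := 1) (v := 1) (w := 0) _ _ _ t0); rewrite ?mul0r ?mulr1 //.
rewrite -[m]muln1; apply: order_ge_ideal_pow ht; apply: fermat_order_ge; rewrite /minn /=; lia.
Qed.

Lemma symbolic_order_y m f : symbolic_power I m f -> order_ge 1 0 1 m f.
Proof.
move=> /symbolic_power_local/(_ y_point_Ass)[t [/= /eqP t0 ht]].
apply: (order_ge_local (t := t) (u := 1) (v := 0) (w := 1) _ _ _ t0); rewrite ?mul0r ?mulr1 //.
rewrite -[m]muln1; apply: order_ge_ideal_pow ht; apply: fermat_order_ge; rewrite /minn /=; lia.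
Qed.

Lemma symbolic_order_x m f : symbolic_power I m f -> order_ge 0 1 1 m f.
Proof.
move=> /symbolic_power_local/(_ x_point_Ass)[t [/= /eqP t0 ht]].
apply: (order_ge_local (t := t) (u := 0) (v := 1) (w := 1) _ _ _ t0); rewrite ?mul0r ?mulr1 //.
rewrite -[m]muln1; apply: order_ge_ideal_pow ht; apply: fermat_order_ge; rewrite /minn /=; lia.
Qed.

Definition hom_part d (f : Rg) : Rg := (grade 1 1 1 f)`_d.

Lemma hom_part_sum f : f = \sum_(d < size (grade 1 1 1 f)) hom_part d f.
Proof.
pose h : {rmorphism Rg -> Rg} := (horner_eval 1 \o grade 1 1 1).
have hf : h f = f.
  have idE : (h : Rg -> Rg) =1 (@idfun Rg : {rmorphism Rg -> Rg}); last exact: idE.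
  apply: rmorph_mpoly3_eq => [k|||];
    by rewrite /h /= ?gradeE /horner_eval ?hornerM ?hornerC ?hornerXn ?expr1n ?mulr1.
rewrite -[LHS]hf /h /= /horner_eval horner_coef; apply: eq_bigr => d _.
by rewrite expr1n mulr1.
Qed.

Lemma hom_partD d p q : hom_part d (p + q) = hom_part d p + hom_part d q.
Proof. by rewrite /hom_part rmorphD coefD. Qed.

Lemma hom_partM c e p d : hom_deg e c ->
  hom_part d (c * p) = if (d < e)%N then 0 else c * hom_part (d - e) p.
Proof.
move=> /hom_degP hc; rewrite /hom_part rmorphM /= hc mulrAC -mulrA coefCM coefMXn.
by case: ifP => // _; rewrite mulr0.
Qed.

Lemma pair_pow_hom_part m f d : J m f -> J m (hom_part d f).
Proof.
elim: m f d => [|m IH] f d //.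
case=> g [h [-> /IH hh]].
have hB : hom_deg (m.+1 * n) (B ^+ m.+1).
  by apply: hom_degX; exact: (@hom_deg_subXn K n i2 i0).
have hA : hom_deg n A by exact: (@hom_deg_subXn K n i1 i2).
rewrite hom_partD.
rewrite (hom_partM _ _ hB) (hom_partM _ _ hA).
apply: (idealD (pair_pow_ideal _ _ _)); case: ifP => _;
  try exact: (ideal0 (pair_pow_ideal _ _ _)).
  exact: pair_pow_bX.
exact: pair_pow_a.
Qed.

Lemma order_ge_hom_part u v w l f d : order_ge u v w l f -> order_ge u v w l (hom_part d f).
Proof.
by move=> o m; rewrite grade_coef; case: ifP => _; [exact: o|rewrite eqxx].
Qed.

Lemma hom_deg_part f d : hom_deg d (hom_part d f).
Proof.
by move=> m; rewrite grade_coef; case: ifP => [/eqP //|_]; rewrite eqxx.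
Qed.

(** An ideal that contains the products of lines of order at least m everywhere
    contains all the polynomials of order at least m everywhere, because all the
    conditions pass to homogeneous parts. *)
Lemma line_prods_sub (Q : set Rg) m f : is_ideal Q ->
  J m f -> order_ge 0 1 1 m f -> order_ge 1 0 1 m f -> order_ge 1 1 0 m f ->
  (forall i j k a b c, line_ord n m m m m i j k a b c -> Q (M i j k a b c)) -> Q f.
Proof.
move=> iQ fJ f1 f2 f3 h; rewrite (hom_part_sum f); apply: ideal_sum => // d _.
have : line_span n m m m m d (hom_part d f).
  apply: (fat_form_line_span hs); split; try exact: order_ge_hom_part.
    exact: pair_pow_hom_part.
  exact: hom_deg_part.
apply=> [|p q|l i j k a b c o _]; first exact: ideal0.
  exact: idealD.
by rewrite -mul_mpolyC; apply: (idealMl _ iQ); exact: h.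
Qed.

Lemma symbolic_sub_pow m r : (r <= m)%N -> (r * n.+1 + 2 * n <= n * m + 3)%N ->
  symbolic_power I m `<=` ideal_pow I r.
Proof.
move=> rm h f hf; apply: (line_prods_sub (m := m)) => //.
- exact: symbolic_pair_pow.
- exact: symbolic_order_x.
- exact: symbolic_order_y.
- exact: symbolic_order_z.
move=> i j k a b c o; apply: line_prod_fermat_pow => //.
  by move: o; rewrite /line_ord; lia.
by move: o; rewrite /line_ord /line_deg; nia.
Qed.

Lemma symbolic_sub m : (0 < m)%N -> symbolic_power I m `<=` I.
Proof.
move=> m0 f hf; apply: (line_prods_sub (m := m)) => //.
- exact: symbolic_pair_pow.
- exact: symbolic_order_x.
- exact: symbolic_order_y.
- exact: symbolic_order_z.
move=> i j k a b c o; apply: line_prod_fermat => //; move: o; rewrite /line_ord; lia.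
Qed.

(** Each point lies off one of the coordinate lines, so that the orders of [f]
    are those of one of its multiples. *)
Lemma fermat_saturated f : I (x * f) -> I (y * f) -> I (z * f) -> I f.
Proof.
move=> hx hy hz; apply: (line_prods_sub (m := 1)) => //.
- apply: (pair_pow_xcancel hs); apply: fermat_pow_pair_pow; exact: ideal_pow1.
- apply: (order_ge_cancel (e := 0) (l := 1) (p := x) (q' := x%:P)).
  + by apply: fermat_order_ge hx; rewrite /minn /=; lia.
  + by rewrite gradex mulrC.
  + by rewrite coefC mpolyX_neq0.
- apply: (order_ge_cancel (e := 0) (l := 1) (p := y) (q' := y%:P)).
  + by apply: fermat_order_ge hy; rewrite /minn /=; lia.
  + by rewrite gradey mulrC.
  + by rewrite coefC mpolyX_neq0.
- apply: (order_ge_cancel (e := 0) (l := 1) (p := z) (q' := z%:P)).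
  + by apply: fermat_order_ge hz; rewrite /minn /=; lia.
  + by rewrite gradez mulrC.
  + by rewrite coefC mpolyX_neq0.
exact: line_prod_fermat.
Qed.

End Symbolic.

(** * Powers of the product ABC *)

Section Lower.
Variables (S : comNzRingType) (n : nat) (x y z : S).
Local Notation A := (y ^+ n - z ^+ n).
Local Notation B := (z ^+ n - x ^+ n).
Local Notation C := (x ^+ n - y ^+ n).

(** Near a coordinate point, say (0 : 0 : 1), the factors A and B are invertible,
    so that the ideal is locally (x, y) and C = x^n - y^n lies in its [n]-th power. *)
Lemma ideal_pow_subXn (I : set S) (u v a b : S) : I (u * a) -> I (v * b) ->
  ideal_pow I n ((a * b) ^+ n * (u ^+ n - v ^+ n)).
Proof.
move=> hu hv; have -> : (a * b) ^+ n * (u ^+ n - v ^+ n) =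
    b ^+ n * (u * a) ^+ n - a ^+ n * (v * b) ^+ n by rewrite !exprMn; ring.
have h w : I w -> ideal_pow I n (w ^+ n).
  by move=> Iw; rewrite -[X in ideal_pow _ X]muln1; apply: ideal_powX; exact: ideal_pow1.
by apply: (idealB (ideal_pow_ideal _ _)); apply: (idealMl _ (ideal_pow_ideal _ _)); apply: h.
Qed.

Lemma fermat_pow3 : ideal_pow (fermat n x y z) 3 ((x * y * z) * (A * B * C)).
Proof.
have -> : (x * y * z) * (A * B * C) = (x * A) * ((y * B) * (z * C)) by ring.
apply: ideal_powMI; first exact: fermat_x.
apply: ideal_powMI; first exact: fermat_y.
by apply: ideal_pow1; exact: fermat_z.
Qed.
End Lower.

Lemma symbolic_powerI (A : idomainType) (I : set A) m f :
  (forall P, Ass I P -> exists s, ~ P s /\ ideal_pow I m (s * f)) ->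
  symbolic_power I m f.
Proof.
move=> h P hP; have [s [Ps hs]] := h P hP.
exists (s * f), s; split=> //.
have s0 : s != 0.
  by apply/eqP => s0; apply: Ps; rewrite s0; case: hP => -[[]].
by rewrite tofracM mulrAC divff ?mul1r // tofrac_eq0.
Qed.

Lemma ideal_pow2_sub (A : comNzRingType) (I J : set A) : is_ideal J ->
  (forall f g, I f -> I g -> J (f * g)) -> ideal_pow I 2 `<=` J.
Proof.
move=> iJ h; apply: (ideal_gen_sub iJ) => _ [g Ig ->].
by rewrite !big_ord_recl big_ord0 mulr1; exact: h.
Qed.

Section Expansions.
Variables (S : comNzRingType) (n : nat) (x y z : S).
Local Notation A := (y ^+ n - z ^+ n).
Local Notation B := (z ^+ n - x ^+ n).
Local Notation C := (x ^+ n - y ^+ n).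
Local Notation T i j k := (x ^+ i * y ^+ j * z ^+ k).

Lemma sq_xx : (x * A) * (x * A) =
  (T 2 (n + n) 0 - T 2 n n) + (T 2 0 (n + n) - T 2 n n).
Proof. rewrite !exprD ?exprS ?expr0; ring. Qed.
Lemma sq_yy : (y * B) * (y * B) =
  (T (n + n) 2 0 - T n 2 n) + (T 0 2 (n + n) - T n 2 n).
Proof. rewrite !exprD ?exprS ?expr0; ring. Qed.
Lemma sq_zz : (z * C) * (z * C) =
  (T (n + n) 0 2 - T n n 2) + (T 0 (n + n) 2 - T n n 2).
Proof. rewrite !exprD ?exprS ?expr0; ring. Qed.
Lemma sq_xy : (x * A) * (y * B) =
  (T 1 n.+1 n - T n.+1 n.+1 0) + (T n.+1 1 n - T 1 1 (n + n)).
Proof. rewrite !exprD ?exprS ?expr0; ring. Qed.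
Lemma sq_yz : (y * B) * (z * C) =
  (T n 1 n.+1 - T 0 n.+1 n.+1) + (T n n.+1 1 - T (n + n) 1 1).
Proof. rewrite !exprD ?exprS ?expr0; ring. Qed.
Lemma sq_xz : (x * A) * (z * C) =
  (T n.+1 n 1 - T 1 (n + n) 1) + (T 1 n n.+1 - T n.+1 0 n.+1).
Proof. rewrite !exprD ?exprS ?expr0; ring. Qed.
Lemma three_lines_expand : A * B * C =
  (T n (n + n) 0 - T (n + n) n 0) + (T 0 n (n + n) - T 0 (n + n) n) +
  (T (n + n) 0 n - T n 0 (n + n)).
Proof. rewrite !exprD ?exprS ?expr0; ring. Qed.
End Expansions.

Lemma mul_rot (S : comNzRingType) (a b c : S) : a * b * c = c * a * b.
Proof. by rewrite mulrC mulrA. Qed.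

Section Members.
Variables (K : fieldType) (n : nat) (s : seq K).
Hypothesis hs : full_roots n s.
Let n3 : (3 <= n)%N. Proof. by case: hs. Qed.
Let n_gt0 : (0 < n)%N. Proof. exact: leq_trans n3. Qed.

Local Notation Rg := {mpoly K[3]}.
Local Notation x := ('X_i0 : Rg).
Local Notation y := ('X_i1 : Rg).
Local Notation z := ('X_i2 : Rg).
Local Notation A := (y ^+ n - z ^+ n).
Local Notation B := (z ^+ n - x ^+ n).
Local Notation C := (x ^+ n - y ^+ n).
Local Notation F := (A * B * C).
Local Notation I := (fermat n x y z).

Lemma prime_expr (P : set Rg) f k : prime_ideal P -> P (f ^+ k) -> P f.
Proof.
case=> _ P1 PM; elim: k => [|k IH]; first by rewrite expr0 => /P1.
by rewrite exprS => /PM[|/IH].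
Qed.

(** Let P be an associated prime.  It does not contain x, y and z together, as
    the ideal is saturated.  If it contains two of them, it is the prime of a
    coordinate point and one of A, B, C is locally in the [n]-th power; it cannot
    contain exactly one of them; and if it contains none, then xyz ABC, the
    product of the three generators, shows the claim. *)
Lemma three_lines_symbolic k : symbolic_power I (k * 3) (F ^+ k).
Proof.
apply: symbolic_powerI => P [pP [f Pf]].
have [iP P1 PM] := pP.
have IP g : I g -> P g.
  by rewrite Pf /= => hg; apply: (idealMr _ (ideal_gen_ideal _)).
have noxyz : P x -> P y -> P z -> False.
  rewrite Pf /= => hx hy hz; apply: P1; rewrite Pf /= mul1r.
  exact: (fermat_saturated hs).
have powP g k' : (0 < k')%N -> P g -> P (g ^+ k').
  by case: k' => // k' _ hg; rewrite exprS; apply: (idealMr _ iP).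
have diffP i j : P ('X_i ^+ n - 'X_j ^+ n) -> P 'X_i -> P 'X_j.
  move=> hd hi; apply: (prime_expr (k := n)) => //.
  have -> : 'X_j ^+ n = 'X_i ^+ n - ('X_i ^+ n - 'X_j ^+ n) :> Rg by rewrite subKr.
  by apply: (idealB iP) => //; exact: powP.
have diffP' i j : P ('X_i ^+ n - 'X_j ^+ n) -> P 'X_j -> P 'X_i.
  by move=> hd; apply: diffP; rewrite -opprB; exact: (idealN iP).
have two u v a b : P u -> P v -> I (u * a) -> I (v * b) -> ~ P a -> ~ P b ->
    F = (a * b) * (u ^+ n - v ^+ n) ->
    exists t, ~ P t /\ ideal_pow I (k * 3) (t * F ^+ k).
  move=> hu hv Iu Iv ha hb eF; exists (((a * b) ^+ n) ^+ k); split.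
    by move/(prime_expr pP)/(prime_expr pP)/PM => [].
  rewrite -exprMn; apply: (ideal_pow_le (b := (k * n)%N)); first by nia.
  apply: ideal_powX; rewrite eF mulrCA.
  by apply: (idealMl _ (ideal_pow_ideal _ _)); exact: ideal_pow_subXn.
have Ix : I (x * A) by exact: fermat_x.
have Iy : I (y * B) by exact: fermat_y.
have Iz : I (z * C) by exact: fermat_z.
have [hx|hx] := pselect (P x); have [hy|hy] := pselect (P y);
  have [hz|hz] := pselect (P z).
- by case: (noxyz hx hy hz).
- apply: (two x y A B hx hy Ix Iy) => //.
    by move=> /diffP/(_ hy).
  by move=> /diffP'/(_ hx).
- apply: (two z x C A hz hx Iz Ix); last exact: mul_rot.
    by move=> /diffP/(_ hx).
  by move=> /diffP'/(_ hz).
- have /PM[//|/diffP'/(_ hx)//] := IP _ Iy.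
- apply: (two y z B C hy hz Iy Iz); last exact: (esym (mul_rot _ _ _)).
    by move=> /diffP/(_ hz).
  by move=> /diffP'/(_ hy).
- have /PM[//|/diffP'/(_ hy)//] := IP _ Iz.
- have /PM[//|/diffP'/(_ hz)//] := IP _ Ix.
exists ((x * y * z) ^+ k); split.
  by move/(prime_expr pP)/PM => [/PM[]|].
rewrite -exprMn; apply: ideal_powX; exact: fermat_pow3.
Qed.

Lemma three_lines_neq0 : F != 0.
Proof.
rewrite !mulf_neq0 ?(A_neq0 hs) ?(B_neq0 hs) //.
by apply: (subXn_neq0 hs); rewrite -val_eqE /= !inordK.
Qed.

Lemma three_lines_pow_degree k r : ideal_pow I r (F ^+ k) -> (r * n.+1 <= 3 * n * k)%N.
Proof.
have hI : I `<=` order_ge 1 1 1 n.+1 by apply: (fermat_order_ge hs); rewrite /minn /=; lia.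
move=> /(order_ge_ideal_pow hI) o.
have hF : hom_deg (k * (n + n + n)) (F ^+ k).
  by apply: hom_degX; do ?apply: hom_degM; exact: (@hom_deg_subXn K n).
have F0 : (F ^+ k)@_(mlead (F ^+ k)) != 0.
  by rewrite mleadc_eq0 expf_neq0 // three_lines_neq0.
have := o _ F0; rewrite (hF _ F0); nia.
Qed.

End Members.

(** * The product ABC is not in the square *)

Section Square.
Variables (K : fieldType) (n : nat).
Hypothesis n3 : (3 <= n)%N.

Local Notation Rg := {mpoly K[3]}.
Local Notation x := ('X_i0 : Rg).
Local Notation y := ('X_i1 : Rg).
Local Notation z := ('X_i2 : Rg).
Local Notation A := (y ^+ n - z ^+ n).
Local Notation B := (z ^+ n - x ^+ n).
Local Notation C := (x ^+ n - y ^+ n).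
Local Notation F := (A * B * C).
Local Notation I := (fermat n x y z).

Definition mono3 i j k : 'X_{1..3} := [multinom nth 0%N [:: i; j; k] t | t < 3].
Definition coef3 (p : Rg) i j k := p@_(mono3 i j k).

Lemma mono3E i j k : (mono3 i j k i0 = i) * (mono3 i j k i1 = j) * (mono3 i j k i2 = k).
Proof. by rewrite !mnmE !inordK. Qed.

Lemma mono3P (m : 'X_{1..3}) : m = mono3 (m i0) (m i1) (m i2).
Proof.
apply/mnmP => t; have : t = i0 \/ t = i1 \/ t = i2.
  case: t => -[|[|[|//]]] lt; [left|right; left|right; right]; apply/val_inj;
    by rewrite /= inordK.
by case=> [->|[->|->]]; rewrite mono3E.
Qed.

Lemma coef3_mul h a b c i j k : coef3 (h * (x ^+ a * y ^+ b * z ^+ c)) i j k =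
  if [&& a <= i, b <= j & c <= k]%N then coef3 h (i - a) (j - b) (k - c) else 0.
Proof.
have -> : x ^+ a * y ^+ b * z ^+ c = 'X_[mono3 a b c] by rewrite [RHS]mpolyX3 !mono3E.
case: ifP => [/and3P[ha hb hc]|hn].
  rewrite /coef3 -(mcoeffMX h (mono3 a b c)); congr (_ @_ _).
  rewrite [LHS]mono3P [RHS]mono3P !mnmDE !mono3E.
  by rewrite !subnKC.
apply/eqP; rewrite /coef3 mcoeff_eq0 (perm_mem (msuppMX _ _)).
apply: contraFN hn => /mapP[m' _ /(congr1 (fun m : 'X_{1..3} => (m i0, m i1, m i2)))].
rewrite !mono3E !mnmDE !mono3E => -[-> -> ->].
by rewrite !leq_addr.
Qed.

Lemma coef3_mono a b c i j k : coef3 (x ^+ a * y ^+ b * z ^+ c) i j k =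
  [&& a == i, b == j & c == k]%:R.
Proof.
have -> : x ^+ a * y ^+ b * z ^+ c = 'X_[mono3 a b c] by rewrite [RHS]mpolyX3 !mono3E.
rewrite /coef3 mcoeffX; congr (nat_of_bool _)%:R.
apply/eqP/and3P => [/(congr1 (fun m : 'X_{1..3} =>
  (m i0, m i1, m i2)))|[/eqP-> /eqP-> /eqP->] //].
by rewrite !mono3E => -[-> -> ->].
Qed.

Lemma coef3D p q i j k : coef3 (p + q) i j k = coef3 p i j k + coef3 q i j k.
Proof. exact: mcoeffD. Qed.
Lemma coef3N p i j k : coef3 (- p) i j k = - coef3 p i j k.
Proof. exact: mcoeffN. Qed.

(** Equal coefficients of x^(2n) y^n and of y^n z^(2n), for all the multiples.
    Of the products of two generators only (y B)^2 contributes to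
    these coefficients, and it does so symmetrically in x and z; in ABC, which is
    antisymmetric, they are -1 and 1. *)
Definition balanced : set Rg :=
  [set f | forall h, coef3 (h * f) (n + n) n 0 = coef3 (h * f) 0 n (n + n)].

Lemma balanced_ideal : is_ideal balanced.
Proof.
split=> /=.
- by move=> h; rewrite mulr0 /coef3 !mcoeff0.
- by move=> f g hf hg h; rewrite mulrDr !coef3D hf hg.
- by move=> a f hf h; rewrite mulrA; exact: hf.
Qed.

Lemma coef3_gt a b c i j k h : (i < a)%N || (j < b)%N || (k < c)%N ->
  coef3 (h * (x ^+ a * y ^+ b * z ^+ c)) i j k = 0.
Proof. by move=> lt; rewrite coef3_mul; case: ifP => // /and3P[*]; exfalso; lia. Qed.

Lemma balanced_gt a b c : (n + n < a)%N || (n < b)%N || (0 < c)%N ->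
  (0 < a)%N || (n < b)%N || (n + n < c)%N -> balanced (x ^+ a * y ^+ b * z ^+ c).
Proof. by move=> h1 h2 h; rewrite !coef3_gt. Qed.

Lemma fermat_sq_balanced f g : I f -> I g -> balanced (f * g).
Proof.
have bI := balanced_ideal.
have coB u : is_ideal [set v : Rg | balanced (u * v)] by exact: colon_ideal.
have bal2 p q r t : balanced p -> balanced q -> balanced r -> balanced t ->
    balanced ((p - q) + (r - t)).
  by move=> *; apply: (idealD bI); apply: (idealB bI).
have xx : balanced ((x * A) * (x * A)).
  by rewrite sq_xx; apply: bal2; apply: balanced_gt; lia.
have yy : balanced ((y * B) * (y * B)).
  rewrite sq_yy addrACA -opprD; apply: (idealB bI); last first.
    by apply: (idealD bI); apply: balanced_gt; lia.
  move=> h; rewrite !mulrDr !coef3D [in LHS](@coef3_gt 0)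
    ?[in RHS](@coef3_gt (n + n)); try lia.
  rewrite addr0 add0r !coef3_mul.
  have -> : [&& n + n <= n + n, 2 <= n & 0 <= 0]%N by lia.
  have -> : [&& 0 <= 0, 2 <= n & n + n <= n + n]%N by lia.
  by rewrite !subnn.
have zz : balanced ((z * C) * (z * C)).
  by rewrite sq_zz; apply: bal2; apply: balanced_gt; lia.
have xy : balanced ((x * A) * (y * B)).
  by rewrite sq_xy; apply: bal2; apply: balanced_gt; lia.
have yz : balanced ((y * B) * (z * C)).
  by rewrite sq_yz; apply: bal2; apply: balanced_gt; lia.
have xz : balanced ((x * A) * (z * C)).
  by rewrite sq_xz; apply: bal2; apply: balanced_gt; lia.
have comm u v : balanced (u * v) -> balanced (v * u) by rewrite mulrC.
have half u : balanced (u * (x * A)) -> balanced (u * (y * B)) ->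
    balanced (u * (z * C)) -> I `<=` [set v | balanced (u * v)].
  exact: fermat_sub.
move=> hf hg; apply: (half f _ _ _ g hg).
- exact: (comm _ _ (half _ xx xy xz f hf)).
- exact: (comm _ _ (half _ (comm _ _ xy) yy yz f hf)).
- exact: (comm _ _ (half _ (comm _ _ xz) (comm _ _ yz) zz f hf)).
Qed.

Lemma three_lines_notin_sq : 2%N \notin [pchar K] -> ~ ideal_pow I 2 F.
Proof.
move=> h2 hF.
have := ideal_pow2_sub balanced_ideal fermat_sq_balanced hF.
move=> /(_ 1); rewrite [1 * _]mul1r three_lines_expand !(coef3D, coef3N) !coef3_mono.
have e1 : (n == n + n)%N = false by apply/eqP; lia.
have e2 : (n + n == n)%N = false by apply/eqP; lia.
have e3 : (0 == n + n)%N = false by apply/eqP; lia.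
have e4 : (n + n == 0)%N = false by apply/eqP; lia.
have e5 : (0 == n)%N = false by apply/eqP; lia.
have e6 : (n == 0)%N = false by apply/eqP; lia.
rewrite !eqxx e1 e2 e3 e4 e5 e6 /= !oppr0 !addr0 !add0r => /eqP.
rewrite eq_sym -addr_eq0 -mulr2n => /eqP e; move: h2; rewrite inE /= => /negP; apply.
by apply/eqP; rewrite -e.
Qed.
End Square.

(** * The two resurgences *)

Lemma ratio_le (R : realType) (a b c d : nat) : (0 < b)%N -> (0 < d)%N ->
  (a%:R / b%:R <= c%:R / d%:R :> R) = (a * d <= c * b)%N.
Proof.
move=> b0 d0; rewrite ler_pdivrMr ?ltr0n // mulrAC ler_pdivlMr ?ltr0n //.
by rewrite -!natrM ler_nat.
Qed.

Section Main.
Variables (R : realType) (K : fieldType) (n : nat) (s : seq K).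
Hypothesis hs : full_roots n s.
Let n3 : (3 <= n)%N. Proof. by case: hs. Qed.
Let n_gt0 : (0 < n)%N. Proof. exact: leq_trans n3. Qed.
Local Notation Rg := {mpoly K[3]}.
Local Notation x := ('X_i0 : Rg).
Local Notation y := ('X_i1 : Rg).
Local Notation z := ('X_i2 : Rg).
Local Notation I := (fermat n x y z).

Lemma fermat_asymptotic_resurgence :
  asymptotic_resurgence R I = (n.+1%:R / n%:R)%:E.
Proof.
apply/eqP; rewrite eq_le; apply/andP; split.
  apply: ge_ereal_sup => _ [m [r [m0 r0 [t0 h] ->]]].
  rewrite lee_fin ratio_le // leqNgt; apply/negP => lt.
  pose t := (t0 + 2 * n)%N.
  apply: (h t); first exact: leq_addr.
  by apply: (symbolic_sub_pow hs); rewrite /t; nia.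
(* The powers (ABC)^(N (n+1)), for N > 0, give ratios 3N(n+1)/(3Nn+1); the
     summand 1 keeps the degree 3nN(n+1) below the initial degree of the power. *)
have low N : (((3 * N.+1 * n.+1)%:R / (3 * N.+1 * n).+1%:R)%:E <= asymptotic_resurgence R I)%E.
  apply: ereal_sup_ubound.
  exists (3 * N.+1 * n.+1)%N, (3 * N.+1 * n).+1; split=> //.
  exists 1%N => t t1 sub.
  have := three_lines_symbolic hs (N.+1 * n.+1 * t).
  have -> : (N.+1 * n.+1 * t * 3 = 3 * N.+1 * n.+1 * t)%N by ring.
  move=> /sub /(three_lines_pow_degree hs).
  have q0 : (0 < t * n.+1)%N by rewrite muln_gt0 t1.
  have -> : ((3 * N.+1 * n).+1 * t * n.+1 = 3 * N.+1 * n * (t * n.+1) + t * n.+1)%N by ring.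
  have -> : (3 * n * (N.+1 * n.+1 * t) = 3 * N.+1 * n * (t * n.+1))%N by ring.
  by rewrite -[X in (_ <= X)%N]addn0 leq_add2l leqNgt q0.
move: low; case: (asymptotic_resurgence R I) => [r||] low; last 2 first.
- by rewrite leey.
- by move: (low 0%N); rewrite leeNy_eq.
(* These ratios increase to (n+1)/n. *)
rewrite lee_fin leNgt; apply/negP; rewrite ltr_pdivlMr ?ltr0n // => lt.
have gap : 0 < n.+1%:R - r * n%:R by rewrite subr_gt0.
have := archi_boundP (divr_ge0 (normr_ge0 r) (ltW gap)); set N := Num.bound _ => hN.
have := low N; rewrite lee_fin ler_pdivrMr ?ltr0n //.
move: hN; rewrite ltr_pdivrMr // => hN.
have e1 : ((3 * N.+1 * n).+1%:R : R) = 3 * (N%:R + 1) * n%:R + 1.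
  by rewrite -natr1 !natrM -[N.+1%:R]natr1.
have e2 : ((3 * N.+1 * n.+1)%:R : R) = 3 * (N%:R + 1) * n.+1%:R.
  by rewrite !natrM -[N.+1%:R]natr1.
rewrite e1 e2 => h.
have : `|r| < r.
  apply: lt_le_trans hN _.
  have N0 : 0 <= N%:R :> R by rewrite ler0n.
  move: gap N0 h; move: (N%:R : R) (n.+1%:R : R) (n%:R : R) => u v w gap N0 h.
  by nra.
by rewrite ltNge ler_norm.
Qed.

Lemma fermat_resurgence : 2%N \notin [pchar K] ->
  resurgence R I = (3%:R / 2%:R)%:E.
Proof.
move=> h2; apply/eqP; rewrite eq_le; apply/andP; split.
  apply: ge_ereal_sup => _ [m [r [m0 r0 h ->]]].
  rewrite lee_fin ratio_le // leqNgt; apply/negP => lt; apply: h.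
  have [r1|r1] := leqP r 1.
    have -> : r = 1%N by lia.
    by move=> f /(symbolic_sub hs m0); exact: ideal_pow1.
  apply: (symbolic_sub_pow hs); first by lia.
  have [r2|r3] := leqP r 2.
    have := leq_mul (leqnn n) (_ : 4 <= m)%N; have -> : r = 2%N by lia.
    by move=> /(_ ltac:(lia)); lia.
  have h1 := leq_mul (leqnn n) (_ : 3 * r + 1 <= m * 2)%N.
  have := h1 ltac:(lia); have : (0 <= (n - 2) * (r - 3))%N by []; nia.
apply: ereal_sup_ubound; exists 3%N, 2%N; split=> // sub.
apply: (three_lines_notin_sq n3 h2); apply: sub.
by have := three_lines_symbolic hs 1; rewrite expr1.
Qed.
End Main.

Theorem theorem2p1 (R : realType) (n : nat) (K : fieldType)
    (hn : (3 <= n)%N)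
    (hchar : 2%N \notin [pchar K])
    (hroots : exists s : seq K,
        [/\ uniq s, size s = n & all (fun w => w ^+ n == 1) s]) :
  let x : {mpoly K[3]} := 'X_(inord 0) in
  let y : {mpoly K[3]} := 'X_(inord 1) in
  let z : {mpoly K[3]} := 'X_(inord 2) in
  let I : set {mpoly K[3]} :=
    ideal_gen [set x * (y ^+ n - z ^+ n);
                   y * (z ^+ n - x ^+ n);
                   z * (x ^+ n - y ^+ n)] in
  asymptotic_resurgence R I = (n.+1%:R / n%:R)%:E /\
  resurgence R I = (3%:R / 2%:R)%:E.
Proof.
move=> x y z I; have [s [us ss hs]] := hroots.
have h : full_roots n s by [].
split; [exact: (fermat_asymptotic_resurgence R h)|exact: (fermat_resurgence R h)].
Qed.
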